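(* Fix a realization of the coefficient $A$. Assume that for constants $C_1,C_2>0$ $$C_1\|v\|_a^2\le a(\mathcal P v,v)\le C_2\|v\|_a^2\qquad\forall v\in V_h,$$ and that $$\eta:=\sup_{v\in V_h\setminus\{0\}}\frac{|a((\widetilde{\mathcal P}-\mathcal P)v,v)|}{\|v\|_a^2}<C_1.$$ Let $u_h\in V_h$ denote the solution of $\mathcal L u_h=f$, and let $\tilde u_h^{(k)}$ be the $k$-th iterate of the preconditioned conjugate gradient method for this system with preconditioner $\widetilde{\mathcal B}$ and initial guess $\tilde u_h^{(0)}\in V_h$. Then $$\|u_h-\tilde u_h^{(k)}\|_a\le 2\left(\frac{\sqrt{\kappa(\widetilde{\mathcal P})}-1}{\sqrt{\kappa(\widetilde{\mathcal P})}+1}\right)^k\|u_h-\tilde u_h^{(0)}\|_a .$$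
   Context: Domain and spaces. $\Omega\subset\mathbb R^d$, $d\in\{1,2,3\}$, is the unit hypercube, with nested uniform Cartesian meshes $\mathcal T_h$ (fine) and $\mathcal T_H$ (coarse), $H>h$, where $\mathcal T_h$ is a refinement of $\mathcal T_H$. $V_h\subset H_0^1(\Omega)$ is the conforming $Q_1$ finite element space (continuous, piecewise multilinear) on $\mathcal T_h$ and $V_H\subset V_h$ the corresponding space on $\mathcal T_H$. $V_h'$ is the dual of $V_h$ with pairing $\langle\cdot,\cdot\rangle$; $f\in L^2(\Omega)$ is identified with the functional $v\mapsto\int_\Omega fv\,dx$ in $V_h'$. Let $\{\varphi_i\}_{i\in\mathcal N}$, $\mathcal N=\{1,\dots,|\mathcal N|\}$, be the nodal basis of $V_H$ (one function per interior coarse vertex). The patches are $\omega_i=\operatorname{supp}\varphi_i$ and the local spaces are $V_i=V_h\cap H_0^1(\omega_i)$ for $i\in\mathcal N$ (functions extended by zero), and $V_0:=V_H$. All patches are translates of one reference patch $\widehat\omega$. Coefficient. Let $\varepsilon$ satisfy $h\le\varepsilon<H$. Let $A_\varepsilon(x)=A_{\rm per}(x/\varepsilon)$, $B_\varepsilon(x)=B_{\rm per}(x/\varepsilon)$ with scalar $1$-periodic $A_{\rm per},B_{\rm per}$ such that both $A_{\rm per}$ and $A_{\rm per}+B_{\rm per}$ take values in $[\alpha,\beta]$ a.e., with $0<\alpha\le\beta<\infty$. Let $\mathcal Q\subset[0,1]^d$ be the reference defect cell and $I=\{j\in\mathbb Z^d:\varepsilon(j+\mathcal Q)\subset\Omega\}$.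 A realization of the coefficient is $A=A_\varepsilon+\sum_{j\in I}\hat b^j\chi_{\varepsilon(j+\mathcal Q)}B_\varepsilon$ with $\hat b^j\in\{0,1\}$ (realizations of independent Bernoulli variables), and $\alpha\le A\le\beta$ a.e. The coarse mesh is aligned with the periodicity: the restrictions $A_\varepsilon|_T$ are identical (up to translation) for all $T\in\mathcal T_H$. Bilinear form. $a(u,v)=\int_\Omega A\nabla u\cdot\nabla v\,dx$, $\|v\|_a=a(v,v)^{1/2}$, and $\mathcal L:V_h\to V_h'$ is defined by $\langle\mathcal L v,w\rangle=a(v,w)$ for all $v,w\in V_h$. Exact preconditioner. For $i=0,\dots,|\mathcal N|$, $\mathcal B_i:V_h'\to V_i$ is defined by $a(\mathcal B_i g,w)=\langle g,w\rangle$ for all $w\in V_i$. Set $\mathcal P_i=\mathcal B_i\circ\mathcal L$, $\mathcal B=\sum_{i=0}^{|\mathcal N|}\mathcal B_i$, $\mathcal P=\mathcal B\circ\mathcal L=\sum_{i=0}^{|\mathcal N|}\mathcal P_i$. Offline-online preconditioner. The reference coefficients on $\widehat\omega$ are $A^{(0)}=A_\varepsilon|_{\widehat\omega}$ and $A^{(\ell)}=A_\varepsilon|_{\widehat\omega}+\chi_{\varepsilon(j_\ell+\mathcal Q)}B_\varepsilon$ for $\ell=1,\dots,N_{\rm ref}$, where $j_\ell$ enumerates the possible defect positions in $\widehat\omega$; they are transferred to each patch $\omega_i$ by translation (same notation). On each patch the realization is represented as $A|_{\omega_i}=\sum_{\ell=0}^{N_{\rm ref}}\mu_\ell^{(i)}A^{(\ell)}$,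 where for $\ell\ge1$ $\mu_\ell^{(i)}\in\{0,1\}$ indicates whether a defect is present at location $\ell$ in $\omega_i$, and $\mu_0^{(i)}=1-\sum_{\ell\ge1}\mu_\ell^{(i)}$, so $\sum_{\ell=0}^{N_{\rm ref}}\mu^{(i)}_\ell=1$. For $i\in\mathcal N$, $\mathcal B_i^{(\ell)}:V_h'\to V_i$ is defined by $\int_{\omega_i}A^{(\ell)}\nabla(\mathcal B_i^{(\ell)}g)\cdot\nabla w\,dx=\langle g,w\rangle$ for all $w\in V_i$. Set $\widetilde{\mathcal B}_i=\sum_{\ell=0}^{N_{\rm ref}}\mu_\ell^{(i)}\mathcal B_i^{(\ell)}$ for $i\in\mathcal N$, $\widetilde{\mathcal B}=\mathcal B_0+\sum_{i\ge1}\widetilde{\mathcal B}_i$ and $\widetilde{\mathcal P}=\widetilde{\mathcal B}\circ\mathcal L:V_h\to V_h$. Condition number and PCG. For an operator on $V_h$ that is symmetric and positive definite with respect to $a(\cdot,\cdot)$, $\kappa$ denotes the ratio of its largest to its smallest eigenvalue. The $k$-th PCG iterate (in exact arithmetic) is the standard one, i.e. the unique minimizer of $\|u_h-w\|_a$ over $w\in\tilde u_h^{(0)}+\operatorname{span}\{\widetilde{\mathcal P}^{\,j}e^{(0)}:1\le j\le k\}$, where $e^{(0)}=u_h-\tilde u_h^{(0)}$ (note $\widetilde{\mathcal P}e^{(0)}=\widetilde{\mathcal B}(f-\mathcal L\tilde u_h^{(0)})$). *)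

(* Defs.v *)
From HB Require Import structures.
From mathcomp Require Import all_boot all_order all_algebra.
From mathcomp Require Import all_classical all_reals all_analysis.

Set Implicit Arguments.
Unset Strict Implicit.
Unset Printing Implicit Defensive.

Import Order.TTheory GRing.Theory Num.Theory.
Import numFieldNormedType.Exports.

Local Open Scope classical_set_scope.
Local Open Scope ring_scope.

(* The sigma-algebra generated by the coordinates, i.e. the Borel sets. *)
Section rV_measurable.
Context {R : realType} {d : nat}.

Let coord : 'I_d -> 'rV[R]_d -> measurableTypeR R := fun i x => x 0 i.

Let rV_set0 : g_sigma_preimage coord set0.
Proof. exact: sigma_algebra0. Qed.

Let rV_setC A : g_sigma_preimage coord A -> g_sigma_preimage coord (~` A).
Proof. exact: sigma_algebraC. Qed.

Let rV_bigcup (F : _^nat) : (forall i, g_sigma_preimage coord (F i)) ->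
  g_sigma_preimage coord (\bigcup_i (F i)).
Proof. exact: sigma_algebra_bigcup. Qed.

HB.instance Definition _ := @isMeasurable.Build default_measure_display
  'rV[R]_d (g_sigma_preimage coord) rV_set0 rV_setC rV_bigcup.

Lemma measurable_rV_coord (i : 'I_d) :
  measurable_fun [set: 'rV[R]_d]
    (fun x : 'rV[R]_d => x 0 i : measurableTypeR R).
Proof.
move=> _ Y mY; rewrite setTI; apply: sub_sigma_algebra => /=.
rewrite -bigcup_seq/=; exists i => /=; first by rewrite mem_index_enum.
by exists Y => //; rewrite setTI.
Qed.

Lemma measurable_fun_rV d1 (T1 : measurableType d1) (f : T1 -> 'rV[R]_d) :
  (forall i, measurable_fun [set: T1]
     (fun t => f t 0 i : measurableTypeR R)) ->
  measurable_fun [set: T1] f.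
Proof.
move=> mf _ Y mY.
have sI := sigma_algebra_image f (@sigma_algebra_measurable _ T1).
suff : g_sigma_preimage coord `<=` image_set_system setT f measurable by apply.
apply: smallest_sub; first exact: sI.
rewrite -bigcup_seq => A [i _ [B mB <-]].
rewrite /image_set_system/= setTI.
exact: mf.
Qed.

End rV_measurable.

Section lebesgue_rV.
Context {R : realType}.

Definition rV_cons d (p : measurableTypeR R * 'rV[R]_d) : 'rV[R]_d.+1 :=
  row_mx (p.1 : R)%:M p.2.

Definition rV_uncons d (x : 'rV[R]_d.+1) : measurableTypeR R * 'rV[R]_d :=
  (x 0 ord0, \row_i x 0 (lift ord0 i)).

Lemma rV_consE0 d p : @rV_cons d p 0 ord0 = p.1.
Proof.
rewrite /rV_cons (_ : ord0 = lshift d (ord0 : 'I_1)); last exact: val_inj.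
by rewrite (@row_mxEl _ 1 1 d) mxE eqxx mulr1n.
Qed.

Lemma rV_consES d p i : @rV_cons d p 0 (lift ord0 i) = p.2 0 i.
Proof.
rewrite /rV_cons (_ : lift ord0 i = rshift 1 i); last exact: val_inj.
by rewrite (@row_mxEr _ 1 1 d).
Qed.

Lemma rV_consK d : cancel (@rV_cons d) (@rV_uncons d).
Proof.
move=> [t x]; rewrite /rV_uncons rV_consE0/=; congr pair.
by apply/rowP => i; rewrite mxE rV_consES.
Qed.

Lemma measurable_rV_cons d : measurable_fun setT (@rV_cons d).
Proof.
apply: measurable_fun_rV => i; have [->|i0] := eqVneq i ord0.
  by under eq_fun do rewrite rV_consE0; exact: measurable_fst.
have [j ->] : exists j, i = lift ord0 j.
  by case: (unliftP ord0 i) i0 => [j ->|->]; [exists j|rewrite eqxx].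
under eq_fun do rewrite rV_consES.
exact: (measurableT_comp (measurable_rV_coord j) measurable_snd).
Qed.

Lemma measurable_rV_uncons d : measurable_fun setT (@rV_uncons d).
Proof.
apply/measurable_fun_pairP; split; first exact: measurable_rV_coord.
apply: measurable_fun_rV => i; rewrite /rV_uncons /=.
under eq_fun do rewrite mxE.
exact: measurable_rV_coord.
Qed.

Section step.
Context (d : nat) (mu : {sigma_finite_measure set 'rV[R]_d -> \bar R}).

Let lm : {sigma_finite_measure set (measurableTypeR R) -> \bar R} :=
  lebesgue_measure.

Definition lebesgue_rV_step : set 'rV[R]_d.+1 -> \bar R :=
  pushforward (lm \x mu)%E (@rV_cons d).

Let step0 : lebesgue_rV_step set0 = 0%E.
Proof. by rewrite /lebesgue_rV_step /pushforward preimage_set0 measure0. Qed.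

Let step_ge0 A : (0 <= lebesgue_rV_step A)%E.
Proof. by rewrite /lebesgue_rV_step /pushforward measure_ge0. Qed.

Let step_sigma_additive : semi_sigma_additive lebesgue_rV_step.
Proof.
apply: (@measure_semi_sigma_additive _ _ _ (pushforward _ _)).
exact: measurable_rV_cons.
Qed.

HB.instance Definition _ := isMeasure.Build _ _ _ lebesgue_rV_step
  step0 step_ge0 step_sigma_additive.

Let step_sigma_finite : sigma_finite setT lebesgue_rV_step.
Proof.
have /sigma_finiteP[F [TF ndF Foo]] := sigma_finiteT lm.
have /sigma_finiteP[G [TG ndG Goo]] := sigma_finiteT mu.
have preE n : @rV_cons d @^-1` (@rV_uncons d @^-1` (F n `*` G n)) = F n `*` G n.
  rewrite -comp_preimage (_ : _ \o _ = id) ?preimage_id//.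
  by apply/funext => p; exact: rV_consK.
have mFG n : measurable (F n `*` G n).
  by apply: measurableX; [have [] := Foo n|have [] := Goo n].
exists (fun n => @rV_uncons d @^-1` (F n `*` G n)) => [|k].
  apply/seteqP; split => // x _.
  have [n _ Fn] : (\bigcup_i F i) (rV_uncons x).1 by rewrite -TF.
  have [k _ Gk] : (\bigcup_i G i) (rV_uncons x).2 by rewrite -TG.
  exists (maxn n k) => //; split.
    exact: (subsetPset _ _ (ndF _ _ (leq_maxl n k))).
  exact: (subsetPset _ _ (ndG _ _ (leq_maxr n k))).
split; first by rewrite -[X in measurable X]setTI; exact: measurable_rV_uncons.
rewrite /lebesgue_rV_step /pushforward preE.
have [? ?] := Foo k; have [? ?] := Goo k.
by rewrite product_measure1E// lte_mul_pinfty// ge0_fin_numE.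
Qed.

HB.instance Definition _ := Measure_isSigmaFinite.Build _ _ _
  lebesgue_rV_step step_sigma_finite.

End step.

Fixpoint lebesgue_rV d : {sigma_finite_measure set 'rV[R]_d -> \bar R} :=
  match d with
  | 0 => \d_(0 : 'rV[R]_0)
  | d.+1 => lebesgue_rV_step (lebesgue_rV d)
  end.

End lebesgue_rV.

Section Q1_space.
Context {R : realType} (d N : nat).

Definition unit_cube : set 'rV[R]_d := [set x | forall i, 0 <= x 0 i <= 1].

Definition mesh_cell (k : {ffun 'I_d -> 'I_N}) : set 'rV[R]_d :=
  [set x | forall i, (k i)%:R / N%:R <= x 0 i <= (k i).+1%:R / N%:R].

Definition multilinear (c : {set 'I_d} -> R) (x : 'rV[R]_d) : R :=
  \sum_S c S * \prod_(i in S) x 0 i.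

(* The closed cube represents the domain, which only changes it by a null set.
   Elements are extended by zero to R^d: a continuous function vanishing off
   the closed cube also vanishes on its boundary. *)
Definition Q1 : {pred 'rV[R]_d -> R} := fun v =>
  `[< [/\ continuous v,
          forall x, ~ unit_cube x -> v x = 0 &
          forall k, exists c, forall x, mesh_cell k x -> v x = multilinear c x]
   >].

Lemma Q1_submod_closed : submod_closed Q1.
Proof.
split.
  apply/asboolP; split => // [|k]; first exact: (@cst_continuous _ R 0).
  exists (fun=> 0) => x _; rewrite /multilinear big1// => S _.
  by rewrite mul0r.
move=> a u v /asboolP[uC u0 uQ] /asboolP[vC v0 vQ]; apply/asboolP; split.
- by move=> x; exact: (cvgD (cvgZl_tmp (uC x)) (vC x)).
- by move=> x xD; rewrite !fctE u0// v0// scaler0 addr0.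
- move=> k; have [c uE] := uQ k; have [e vE] := vQ k.
  exists (fun S => a * c S + e S) => x kx.
  rewrite !fctE uE// vE// /multilinear scaler_sumr -big_split/=.
  by apply: eq_bigr => S _; rewrite mulrDl -mulrA.
Qed.

HB.instance Definition _ := GRing.isSubmodClosed.Build _ _ Q1 Q1_submod_closed.

Record Q1_space := Q1Space { Q1_val :> 'rV[R]_d -> R; _ : Q1_val \in Q1 }.

HB.instance Definition _ := [isSub for Q1_val].
HB.instance Definition _ := [Choice of Q1_space by <:].
HB.instance Definition _ := [SubChoice_isSubLmodule of Q1_space by <:].

End Q1_space.

Arguments unit_cube {R} d.
Arguments Q1 R d N : clear implicits.
Arguments Q1_space R d N : clear implicits.

Section patches.
Context {R : realType} (d n M : nat).

Definition interior_vertex (i : {ffun 'I_d -> 'I_M.-1}) : 'rV[R]_d :=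
  \row_k ((i k).+1%:R / M%:R).

(* For n a multiple of M this is the coarse space itself, as Q1 R d M is then
   contained in Q1 R d n. *)
Definition coarse_space : set (Q1_space R d n) :=
  [set v | (v : 'rV[R]_d -> R) \in Q1 R d M].

Definition nodal_basis (phi : {ffun 'I_d -> 'I_M.-1} -> Q1_space R d n) :=
  forall i, coarse_space (phi i) /\
    forall j, phi i (interior_vertex j) = (i == j)%:R.

Definition support_of (v : 'rV[R]_d -> R) : set 'rV[R]_d :=
  closure [set x | v x != 0].

(* The functions of V_h are continuous on R^d, so vanishing off the closed
   set D is membership in H^1_0 of D, with extension by zero. *)
Definition patch_space (D : set 'rV[R]_d) : set (Q1_space R d n) :=
  [set v | forall x, ~ D x -> v x = 0].

End patches.

Arguments coarse_space {R d n} M.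
Arguments patch_space {R d n} D.

Section coefficients.
Context {R : realType} {d : nat}.
Implicit Types (eps : R) (Aper Bper : 'rV[R]_d -> R) (Q D : set 'rV[R]_d).
Implicit Types (b : 'rV[int]_d -> bool) (t : 'rV[R]_d).

Definition int_vec (j : 'rV[int]_d) : 'rV[R]_d := map_mx intr j.

Definition unit_periodic (g : 'rV[R]_d -> R) :=
  forall j x, g (x + int_vec j) = g x.

Definition oscillating eps (g : 'rV[R]_d -> R) (x : 'rV[R]_d) : R :=
  g (eps^-1 *: x).

Definition defect_cell eps Q j : set 'rV[R]_d :=
  [set eps *: (int_vec j + q) | q in Q].

Definition defect_sites eps Q D : set 'rV[int]_d :=
  [set j | defect_cell eps Q j `<=` D].

Definition realization eps Aper Bper Q b (x : 'rV[R]_d) : R :=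
  oscillating eps Aper x +
  \sum_(j \in defect_sites eps Q (unit_cube d))
    (b j)%:R * \1_(defect_cell eps Q j) x * oscillating eps Bper x.

Section reference.
Context (Nref : nat) (jref : 'I_Nref -> 'rV[int]_d).

Definition reference_coef eps Aper Bper Q (l : 'I_Nref.+1) (y : 'rV[R]_d) : R :=
  oscillating eps Aper y +
  if unlift ord0 l is Some k
  then \1_(defect_cell eps Q (jref k)) y * oscillating eps Bper y else 0.

(* The reference location jref k sits, in the patch translated by t, at the
   lattice index j such that eps j = eps (jref k) + t. *)
Definition defect_present eps Q b t (k : 'I_Nref) : Prop :=
  exists j, [/\ defect_sites eps Q (unit_cube d) j, b j &
                eps *: int_vec j = eps *: int_vec (jref k) + t].

Definition patch_weight eps Q b t (l : 'I_Nref.+1) : R :=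
  if unlift ord0 l is Some k then `[< defect_present eps Q b t k >]%:R
  else 1 - \sum_(k < Nref) `[< defect_present eps Q b t k >]%:R.

End reference.

(* For the piecewise multilinear functions of Q1_space the classical partial
   derivatives exist off the mesh faces and are the weak ones. *)
Definition grad_dot (u v : 'rV[R]_d -> R) (x : 'rV[R]_d) : R :=
  \sum_(i < d) 'D_(delta_mx 0 i) u x * 'D_(delta_mx 0 i) v x.

Definition energy D (c u v : 'rV[R]_d -> R) : R :=
  \int[lebesgue_rV d]_(x in D) (c x * grad_dot u v x).

Definition L2_pairing D (f v : 'rV[R]_d -> R) : R :=
  \int[lebesgue_rV d]_(x in D) (f x * v x).

Definition L2 D (f : 'rV[R]_d -> R) :=
  measurable_fun D f /\
  (lebesgue_rV d).-integrable D (fun x => (f x ^+ 2)%:E).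

End coefficients.

Section operators.
Context {R : realType} {V : lmodType R}.
Implicit Types (a : V -> V -> R) (W : set V) (T : V -> V).

(* An element of the dual of V is a function g : V -> R with scalar g; nothing
   is required of B on other functions. *)
Definition solution_operator a W (B : (V -> R) -> V) :=
  forall g : V -> R, scalar g ->
    W (B g) /\ forall w, W w -> a (B g) w = g w.

Definition additive_preconditioner (I : finType) (B0 : (V -> R) -> V)
    (B : I -> (V -> R) -> V) (g : V -> R) : V :=
  B0 g + \sum_i B i g.

Definition form_norm a (v : V) : R := Num.sqrt (a v v).

(* An extended real, so that an unbounded quotient has supremum +oo. *)
Definition relative_deviation a T1 T2 : \bar R :=
  ereal_sup [set (`|a (T1 v - T2 v) v| / form_norm a v ^+ 2)%:E
            | v in [set v : V | v != 0]].

Definition eigenvalues T : set R :=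
  [set lam | exists2 v, v != 0 & T v = lam *: v].

(* V_h being finite dimensional, sup and inf are the largest and the smallest
   eigenvalue of an operator symmetric with respect to a. *)
Definition condition_number T : R := sup (eigenvalues T) / inf (eigenvalues T).

Definition krylov_affine T (u u0 : V) (k : nat) : set V :=
  [set w | exists c : 'I_k -> R,
     w = u0 + \sum_(j < k) c j *: iter j.+1 T (u - u0)].

Definition pcg_iterate a T (u u0 : V) (k : nat) (uk : V) :=
  krylov_affine T u u0 k uk /\
  forall w, krylov_affine T u u0 k w ->
    form_norm a (u - uk) <= form_norm a (u - w).

End operators.

(* Main.v *)
Require Import Defs.
From HB Require Import structures.
From mathcomp Require Import all_boot all_order all_algebra.
From mathcomp Require Import all_classical all_reals all_analysis.
From mathcomp Require Import measurable_realfun ring lra.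

Import Order.TTheory GRing.Theory Num.Theory.
Import numFieldNormedType.Exports.

Local Open Scope classical_set_scope.
Local Open Scope ring_scope.

Set Implicit Arguments.
Unset Strict Implicit.
Unset Printing Implicit Defensive.

(** The offline-online operator is symmetric and positive definite for the
    energy inner product, so the classical convergence bound of conjugate
    gradients applies to it.

    Symmetry: a local solver [B] for a symmetric form [a'], applied to the
    functional [a v], satisfies [a (B (a u)) v = a' (B (a u)) (B (a v))],
    which is symmetric in [u] and [v] even when [a'] is not [a]
    ([solution_operator_selfadjoint]); sums and real multiples, also with the
    negative weight that the defect-free coefficient may carry, stay
    symmetric. Positivity: the deviation from the exact operator is less than
    its lower bound [C1] ([deviation_positive]).

    Convergence ([conjugate_gradient_rate]): in finite dimension the extreme
    values of the Rayleigh quotient are attained at eigenvectors, so they are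
    the infimum and the supremum of the eigenvalues ([rayleigh_max],
    [extreme_eigenvalues]). The iterate is optimal over the polynomials in the
    operator that are 1 at 0, and a rescaled Chebyshev polynomial is a good
    competitor. No diagonalization is used: the bound [|T_k| <= 1] comes from
    the Pell identity between the two kinds of Chebyshev polynomials, which
    holds for operators as it does for numbers ([chebyshev_pair]).

    What remains is that the energy is an inner product
    ([energy_inner_product]) on a finite dimensional space
    ([Q1_space_finite_basis]). On each open cell a finite element function is
    multilinear, so its gradient there is linear in the function, measurable
    and bounded; the mesh faces, where the gradient need not be measurable,
    are a null set and do not affect integrals ([integral_setD_null]). A
    function of zero energy has a partial derivative that vanishes almost
    everywhere, hence is constant along lines in that direction, hence is zero
    since it vanishes outside the cube ([Q1_eq0]). *)

(** * Self-adjoint operators and Chebyshev polynomials *)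

Section selfadjoint.
Context {R : realType} {V : lmodType R}.
Implicit Types (a : V -> V -> R) (T Z : V -> V).

Definition inner_product a :=
  [/\ forall u v, a u v = a v u, forall u, scalar (a u) &
      forall v, v != 0 -> 0 < a v v].

Definition selfadjoint a T := forall u v, a (T u) v = a u (T v).

Section form.
Variable a : V -> V -> R.
Hypothesis ia : inner_product a.

Lemma innerC u v : a u v = a v u. Proof. by have [+ _ _] := ia. Qed.

Lemma innerP u c v w : a u (c *: v + w) = c * a u v + a u w.
Proof. by have [_ + _] := ia; apply. Qed.

Lemma innerDr u v w : a u (v + w) = a u v + a u w.
Proof. by rewrite -{1}[v]scale1r innerP mul1r. Qed.

Lemma inner0r u : a u 0 = 0.
Proof. by apply: (addrI (a u 0)); rewrite -innerDr !addr0. Qed.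

Lemma innerZr u c v : a u (c *: v) = c * a u v.
Proof. by rewrite -[c *: v]addr0 innerP inner0r addr0. Qed.

Lemma innerNr u v : a u (- v) = - a u v.
Proof. by rewrite -scaleN1r innerZr mulN1r. Qed.

Lemma inner0l u : a 0 u = 0. Proof. by rewrite innerC inner0r. Qed.

Lemma innerDl u v w : a (u + v) w = a u w + a v w.
Proof. by rewrite innerC innerDr !(innerC w). Qed.

Lemma innerZl c u v : a (c *: u) v = c * a u v.
Proof. by rewrite innerC innerZr innerC. Qed.

Lemma innerNl u v : a (- u) v = - a u v.
Proof. by rewrite innerC innerNr innerC. Qed.

Definition innerE := (innerDl, innerDr, innerZl, innerZr, innerNl, innerNr).

Lemma inner_suml I (r : seq I) (F : I -> V) v :
  a (\sum_(i <- r) F i) v = \sum_(i <- r) a (F i) v.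
Proof. by apply: (big_morph (a^~ v)) => [x y|]; rewrite ?innerDl ?inner0l. Qed.

Lemma inner_sumr I (r : seq I) (F : I -> V) u :
  a u (\sum_(i <- r) F i) = \sum_(i <- r) a u (F i).
Proof. by rewrite innerC inner_suml; apply: eq_bigr => i _; rewrite innerC. Qed.

Lemma inner_gt0 v : v != 0 -> 0 < a v v. Proof. by have [_ _] := ia; apply. Qed.

Lemma inner_ge0 v : 0 <= a v v.
Proof. by have [->|/inner_gt0/ltW//] := eqVneq v 0; rewrite inner0r. Qed.

Lemma inner_inj u v : (forall w, a u w = a v w) -> u = v.
Proof.
move=> uv; apply/eqP; rewrite -subr_eq0; apply: contraT => /inner_gt0.
by rewrite innerDl innerNl uv subrr ltxx.
Qed.

Lemma form_norm_sqr v : form_norm a v ^+ 2 = a v v.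
Proof. by rewrite /form_norm sqr_sqrtr// inner_ge0. Qed.

Lemma form_normZ c v : form_norm a (c *: v) = `|c| * form_norm a v.
Proof.
by rewrite /form_norm innerZl innerZr mulrA -expr2 sqrtrM ?sqr_ge0// sqrtr_sqr.
Qed.

Lemma selfadjoint_linear T : selfadjoint a T ->
  forall c u v, T (c *: u + v) = c *: T u + T v.
Proof.
by move=> aT c u v; apply: inner_inj => w; rewrite aT !innerE !aT.
Qed.

(** Polarization turns a bound on the quadratic form of [Z] into one on the
    bilinear form, and testing against [Z w / r] turns that one into a
    bound on the norm. *)
Lemma selfadjoint_normr_le Z r : selfadjoint a Z -> 0 <= r ->
  (forall w, `|a (Z w) w| <= r * a w w) ->
  forall w, a (Z w) (Z w) <= r ^+ 2 * a w w.
Proof.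
move=> aZ r0 Zr w.
have linZ := selfadjoint_linear aZ.
have pol u : 2 * a (Z w) u <= r * (a w w + a u u).
  have := Zr (1 *: u + w); have := Zr (- 1 *: u + w).
  rewrite !linZ !innerE !ler_norml (aZ u w) (innerC u (Z w)) (innerC u w).
  by move=> /andP[h1 h2] /andP[h3 h4]; lra.
have [r00|rN0] := eqVneq r 0.
  by have := pol (Z w); rewrite r00; lra.
have rgt0 : 0 < r by rewrite lt_def rN0.
have := pol (r^-1 *: Z w); rewrite !innerE.
set x := a (Z w) (Z w); set y := a w w => h.
rewrite -(ler_pM2l (_ : 0 < r^-1)) ?invr_gt0//.
have -> : r^-1 * (r ^+ 2 * y) = r * y by field.
have h2 : r * (r^-1 * (r^-1 * x)) = r^-1 * x by field.
by lra.
Qed.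

(** The vectors [p(T) e] for a polynomial [p] of degree at most [k] with
    [p(0) = c]. *)
Definition krylov T e k (c : R) v :=
  exists b : nat -> R, v = c *: e + \sum_(j < k) b j *: iter j.+1 T e.

Section krylov.
Variables (T : V -> V) (e : V).
Hypothesis aT : selfadjoint a T.

Lemma krylov0 k : krylov T e k 0 0.
Proof.
exists (fun=> 0); rewrite scale0r big1 ?addr0// => j _.
by rewrite scale0r.
Qed.

Lemma krylov1 : krylov T e 0 1 e.
Proof. by exists (fun=> 0); rewrite big_ord0 addr0 scale1r. Qed.

Lemma krylovP k x c v c' v' : krylov T e k c v -> krylov T e k c' v' ->
  krylov T e k (x * c + c') (x *: v + v').
Proof.
move=> [b ->] [b' ->]; exists (fun j => x * b j + b' j).
rewrite scalerDr scaler_sumr scalerDl scalerA addrACA -big_split/=.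
by congr (_ + _); apply: eq_bigr => j _; rewrite scalerDl scalerA.
Qed.

Lemma krylovZ k x c v : krylov T e k c v -> krylov T e k (x * c) (x *: v).
Proof.
by move=> /(krylovP x) /(_ (krylov0 k)); rewrite !addr0.
Qed.

Lemma krylovD k c v c' v' : krylov T e k c v -> krylov T e k c' v' ->
  krylov T e k (c + c') (v + v').
Proof.
by move=> /(krylovP 1) /[apply]; rewrite mul1r scale1r.
Qed.

Lemma krylovS k c v : krylov T e k c v -> krylov T e k.+1 c v.
Proof.
move=> [b ->]; exists (fun j => if (j < k)%N then b j else 0).
rewrite big_ord_recr/= ltnn scale0r addr0; congr (_ + _).
by apply: eq_bigr => j _; rewrite ltn_ord.
Qed.

Lemma krylov_op k c v : krylov T e k c v -> krylov T e k.+1 0 (T v).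
Proof.
have linT := selfadjoint_linear aT.
have T0 : T 0 = 0 by apply: inner_inj => w; rewrite aT !inner0l.
move=> [b ->]; exists (fun j => if j is j'.+1 then b j' else c).
rewrite linT scale0r add0r big_ord_recl/=; congr (_ + _).
rewrite (@big_morph _ _ T 0 +%R)//; last first.
  by move=> x y; rewrite -{1}[x]scale1r linT scale1r.
by apply: eq_bigr => j _; rewrite -[_ *: _]addr0 linT T0 addr0.
Qed.

Variables (z t r : R).
Let Z v := z *: v - t *: T v.

Lemma krylov_shift k c v : krylov T e k c v -> krylov T e k.+1 (z * c) (Z v).
Proof.
move=> kv; rewrite -[z * c]addr0; apply: krylovD.
  by apply: krylovZ; apply: krylovS.
by rewrite -scaleNr -[0](mulr0 (- t)); apply: krylovZ; apply: krylov_op kv.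
Qed.

Lemma selfadjoint_shift : selfadjoint a Z.
Proof. by move=> u v; rewrite /Z !innerE aT. Qed.

(** The vectors are [s = r^k T_k(Z / r) e] and [w = r^(k-1) U_(k-1)(Z / r) e]
    for the Chebyshev polynomials of both kinds, in a form that makes sense
    for [r = 0]: they obey [s' = Z s - (r^2 - Z^2) w] and [w' = s + Z w]. The
    last equation is the Pell identity [T_k^2 + (1 - x^2) U_(k-1)^2 = 1]. The
    scalars [sigma] and [omega] are the values of the two polynomials at
    [T = 0]; since [z +/- (1 - r^2) / 2] is [1] or [r^2], the recurrence
    diagonalizes there, and [sigma = (1 + r^(2k)) / 2]. *)
Lemma chebyshev_pair k : z = (1 + r ^+ 2) / 2 ->
  exists s w sigma omega,
    [/\ krylov T e k sigma s,
        krylov T e k omega w /\ krylov T e k (z * omega) (Z w),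
        sigma + (1 - r ^+ 2) / 2 * omega = 1,
        sigma - (1 - r ^+ 2) / 2 * omega = (r ^+ 2) ^+ k &
        a s s + r ^+ 2 * a w w - a (Z w) (Z w) = (r ^+ 2) ^+ k * a e e].
Proof.
move=> zE; have aZ := selfadjoint_shift.
have Z0 : Z 0 = 0 by apply: inner_inj => w; rewrite aZ !inner0l.
elim: k => [|k [s [w [sigma [omega [ks [kw kZw] s1 s2 sq]]]]]].
  exists e, 0, 1, 0.
  rewrite Z0 inner0r !mulr0 subr0 addr0 expr0 mul1r addr0 subr0.
  by split=> //; [exact: krylov1 | split; exact: krylov0].
exists (Z s - r ^+ 2 *: w + Z (Z w)), (s + Z w).
exists (z * sigma - r ^+ 2 * omega + z * (z * omega)), (sigma + z * omega).
have linZ : Z (s + Z w) = Z s + Z (Z w).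
  by have := selfadjoint_linear aZ 1 s (Z w); rewrite !scale1r.
split.
- apply: krylovD; last exact: krylov_shift.
  apply: krylovD; first exact: krylov_shift.
  by rewrite -(scaleNr _ w) -(mulNr _ omega); apply: krylovZ; apply: krylovS.
- split; first by apply: krylovS; apply: krylovD.
  rewrite linZ mulrDr; apply: krylovD; exact: krylov_shift.
- by rewrite -[RHS]s1 zE; field.
- by rewrite [RHS]exprS -s2 zE; field.
(* Every term is moved to the form [a s (Z^i s)], [a s (Z^i w)] or
   [a w (Z^i w)]. *)
- clearbody Z; rewrite [in RHS]exprS -mulrA -sq linZ !innerE !aZ.
  rewrite ?(innerC w (Z (Z (Z s)))) ?(innerC w (Z (Z s))) ?(innerC w (Z s)).
  rewrite ?(innerC w s) !aZ.
  ring.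
Qed.

End krylov.
End form.
End selfadjoint.

(** * Finite bases and extreme eigenvalues *)

Section finite_dimension.
Context {R : realType} {V : lmodType R}.
Implicit Types (a : V -> V -> R) (T Z : V -> V).

Definition lincomb m (e : 'I_m -> V) (x : 'rV[R]_m) := \sum_i x 0 i *: e i.

Definition finite_basis m (e : 'I_m -> V) :=
  (forall x, lincomb e x = 0 -> x = 0) /\ forall v, exists x, v = lincomb e x.

(** The map [C] need not be linear, but a linear relation between the
    coordinates of a finite family is one between the vectors. So independent
    families have length at most [K], and one of maximal length is a basis. *)
Lemma basis_of_coordinates K (C : V -> 'rV[R]_K) :
  (forall n (e : 'I_n -> V) (x : 'rV[R]_n),
     x *m \matrix_i C (e i) = 0 -> lincomb e x = 0) ->
  exists n (e : 'I_n -> V), finite_basis e.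
Proof.
move=> CP.
pose free n := exists e : 'I_n -> V, forall x, lincomb e x = 0 -> x = 0.
have free_le n : free n -> (n <= K)%N.
  move=> [e ef]; rewrite leqNgt; apply/negP => Kn.
  set A := \matrix_i C (e i).
  have : kermx A != 0.
    rewrite -mxrank_eq0 mxrank_ker subn_eq0 -ltnNge.
    exact: leq_ltn_trans (rank_leq_col A) Kn.
  case/rowV0Pn => x /sub_kermxP xA /negP; apply; apply/eqP.
  exact/ef/CP.
have free0 : exists n, `[< free n >].
  by exists 0%N; apply/asboolP; exists (fun=> 0) => x _; apply/rowP => -[].
have free_ub n : `[< free n >] -> (n <= K)%N by move/asboolP/free_le.
case: (ex_maxnP free0 free_ub) => n /asboolP[e ef] nmax.
exists n, e; split=> // v.
apply: contrapT => vNe.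
suff : free n.+1 by move/asboolP/nmax; rewrite ltnn.
exists (fun i => if unlift ord0 i is Some j then e j else v) => x.
rewrite /lincomb big_ord_recl unlift_none.
under eq_bigr do rewrite liftK.
pose y := \row_j x 0 (lift ord0 j).
rewrite (_ : \sum_(i < n) _ = lincomb e y); last first.
  by apply: eq_bigr => j _; rewrite mxE.
move=> xy0; have [x0|x0] := eqVneq (x 0 ord0) 0.
  move: xy0; rewrite x0 scale0r add0r => /ef/rowP y0.
  apply/rowP => i; rewrite mxE; case: (unliftP ord0 i) => [j|] ->//.
  by have := y0 j; rewrite !mxE.
case: vNe; exists (- (x 0 ord0)^-1 *: y).
have -> : lincomb e (- (x 0 ord0)^-1 *: y) = - (x 0 ord0)^-1 *: lincomb e y.
  by rewrite /lincomb scaler_sumr; apply: eq_bigr => j _; rewrite mxE scalerA.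
move/eqP: xy0; rewrite addr_eq0 => /eqP xy.
by rewrite scaleNr -scalerN -xy scalerA mulVf// scale1r.
Qed.

Variable a : V -> V -> R.
Hypothesis ia : inner_product a.

Lemma continuous_bilinear m (e : 'I_m -> V) T : selfadjoint a T ->
  continuous (fun x => a (T (lincomb e x)) (lincomb e x)).
Proof.
move=> aT; rewrite (_ : (fun _ => _) = fun x : 'rV[R]_m =>
    \sum_i \sum_j x 0 i * x 0 j * a (T (e i)) (e j)).
  apply: continuous_big; first exact: add_continuous.
  move=> i _; apply: continuous_big; first exact: add_continuous.
  move=> j _ x.
  apply: (@continuousM R _ (fun x : 'rV[R]_m => x 0 i * x 0 j) (fun=> _)).
    apply: (@continuousM R _ (fun x : 'rV[R]_m => x 0 i) (fun x => x 0 j));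
      exact: coord_continuous.
  exact: cst_continuous. 
apply/funext => x; rewrite aT {1}/lincomb (inner_suml ia).
apply: eq_bigr => i _.
rewrite (innerZl ia) -aT {1}/lincomb (inner_sumr ia) mulr_sumr.
by apply: eq_bigr => j _; rewrite (innerZr ia) mulrA.
Qed.

(** The Rayleigh quotient attains its maximum on the compact unit sphere of
    the coordinate space. At a maximizer [v] the positive semidefinite form of
    [lam - T] vanishes, so [v] is in its kernel. *)
Lemma rayleigh_max m (e : 'I_m -> V) T : finite_basis e -> selfadjoint a T ->
  (exists v : V, v != 0) ->
  exists lam v,
    [/\ v != 0, T v = lam *: v & forall w, a (T w) w <= lam * a w w].
Proof.
move=> [e_inj e_sur] aT [v0 v0N0].
have linT := selfadjoint_linear ia aT.
pose S := [set x : 'rV[R]_m | `|x| = 1].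
pose q x := a (T (lincomb e x)) (lincomb e x) / a (lincomb e x) (lincomb e x).
have lincombZ c x : lincomb e (c *: x) = c *: lincomb e x.
  by rewrite scaler_sumr; apply: eq_bigr => i _; rewrite mxE scalerA.
have qZ c x : c != 0 -> q (c *: x) = q x.
  move=> c0; rewrite /q lincombZ -[c *: _]addr0 linT.
  have T0 : T 0 = 0 by apply: (inner_inj ia) => w; rewrite aT !(inner0l ia).
  rewrite T0 !addr0 !(innerE ia).
  have [->|d0] := eqVneq (a (lincomb e x) (lincomb e x)) 0.
    by rewrite !mulr0 !invr0 !mulr0.
  by field; rewrite d0 c0.
have toS x : x != 0 -> S (`|x|^-1 *: x).
  move=> x0; rewrite /S/= normrZ normfV normr_id mulVf// normr_eq0//.
have lin0 : lincomb e 0 = 0.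
  by rewrite /lincomb big1// => i _; rewrite mxE scale0r.
have pos x : x != 0 -> 0 < a (lincomb e x) (lincomb e x).
  by move=> /eqP x0; apply: (inner_gt0 ia); apply/eqP => /e_inj.
have S0 : S !=set0.
  have [x xE] := e_sur v0; exists (`|x|^-1 *: x); apply: toS.
  by apply: contra_neq v0N0 => x0; rewrite xE x0.
have SN0 x : S x -> x != 0.
  move=> Sx; apply/eqP => x0; move: Sx.
  by rewrite /S/= x0 normr0 => /esym/eqP; rewrite oner_eq0.
have cS : compact S.
  apply: bounded_closed_compact.
    exists 1; split => // M M1 x Sx; rewrite /globally/= in Sx *.
    by rewrite Sx ltW.
  rewrite (_ : S = Num.norm @^-1` [set x | x = 1])//.
  apply: preimage_closed; last exact: closed_eq.
  by move=> x _; exact: norm_continuous.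
have aid : selfadjoint a id by [].
have qC : {within S, continuous q}.
  apply: continuous_in_subspaceT => x /set_mem /SN0 /pos d0.
  apply: (@continuousM R _ (fun x => a (T (lincomb e x)) (lincomb e x))
    (fun x => (a (lincomb e x) (lincomb e x))^-1)).
    exact: continuous_bilinear.
  apply: (@continuousV R _ (fun x => a (lincomb e x) (lincomb e x))).
    by rewrite gt_eqF.
  exact: (@continuous_bilinear _ e id aid).
have [x /set_mem Sx qx] := EVT_max_rV S0 cS qC.
have xpos := pos _ (SN0 _ Sx).
have vN0 : lincomb e x != 0.
  by apply: contraTneq xpos => ->; rewrite (inner0r ia) ltxx.
have le w : a (T w) w <= q x * a w w.
  have [->|wN0] := eqVneq w 0; first by rewrite !(inner0r ia) mulr0.
  have [y wE] := e_sur w.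
  have y0 : y != 0 by apply: contra_neq wN0 => y0; rewrite wE y0.
  rewrite -ler_pdivrMr ?(inner_gt0 ia)// wE -/(q y).
  rewrite -(qZ `|y|^-1) ?invr_eq0 ?normr_eq0// qx//.
  by apply/mem_set/toS.
exists (q x), (lincomb e x); split=> //.
have eqx : a (T (lincomb e x)) (lincomb e x) =
    q x * a (lincomb e x) (lincomb e x).
  by rewrite /q divfK// gt_eqF.
set v := lincomb e x in xpos le eqx vN0 *.
have [N NE] : exists N, N = T v - q x *: v by exists (T v - q x *: v).
suff : a N N <= 0.
  rewrite le_eqVlt ltNge (inner_ge0 ia) orbF => /eqP N0.
  apply/eqP; rewrite -subr_eq0 -NE; apply: contraT => /(inner_gt0 ia).
  by rewrite N0 ltxx.
(* The nonnegative form of [q x - T] at [v + t N] is [- 2 t |N|^2 + t^2 c],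
   which is negative for small [t > 0] unless [N] is 0. *)
pose c := q x * a N N - a (T N) N.
have c0 : 0 <= c by rewrite subr_ge0.
have tN t : 0 <= - (2 * t) * a N N + t ^+ 2 * c.
  have := le (t *: N + v); rewrite linT.
  rewrite !(innerE ia) (aT N v) (innerC ia v N) (innerC ia (T v) N) eqx.
  have -> : a N (T v) = a N N + q x * a N v.
    by rewrite {3}NE !(innerE ia) subrK.
  rewrite /c; lra.
have := tN (a N N / (c + 1)); set n := a N N => h.
have c1 : c + 1 != 0 by rewrite gt_eqF// ltr_wpDl.
have := mulr_ge0 (sqr_ge0 (c + 1)) h.
have -> : (c + 1) ^+ 2 * (- (2 * (n / (c + 1))) * n + (n / (c + 1)) ^+ 2 * c) =
    - (n ^+ 2 * (c + 2)) by field.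
rewrite oppr_ge0 pmulr_lle0 ?ltr_wpDl// => n2.
have /eqP : n ^+ 2 = 0 by apply/eqP; rewrite eq_le n2 sqr_ge0.
by rewrite sqrf_eq0 => /eqP ->.
Qed.

End finite_dimension.

(** * The convergence rate of conjugate gradients *)

Section conjugate_gradient.
Context {R : realType} {V : lmodType R}.
Implicit Types (a : V -> V -> R) (T Z : V -> V).
Variable a : V -> V -> R.
Hypothesis ia : inner_product a.

Lemma extreme_eigenvalues n (e : 'I_n -> V) T :
  finite_basis e -> selfadjoint a T -> (exists v : V, v != 0) ->
  [/\ eigenvalues T (inf (eigenvalues T)),
      forall w, inf (eigenvalues T) * a w w <= a (T w) w &
      forall w, a (T w) w <= sup (eigenvalues T) * a w w].
Proof.
move=> be aT V0.
have [M [v [vN0 TvE leM]]] := rayleigh_max ia be aT V0.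
have aNT : selfadjoint a (\- T) by move=> x y; rewrite /= !(innerE ia) aT.
have [m' [w [wN0 TwE ge_m']]] := rayleigh_max ia be aNT V0.
pose m := - m'.
have {}TwE : T w = m *: w by rewrite /m scaleNr -TwE opprK.
have ge_m x : m * a x x <= a (T x) x.
  by have := ge_m' x; rewrite /= (innerE ia) /m; lra.
have EM : eigenvalues T M by exists v.
have Em : eigenvalues T m by exists w.
have ev_bnd l : eigenvalues T l -> m <= l <= M.
  move=> [x xN0 TxE]; have := leM x; have := ge_m x.
  by rewrite TxE (innerZl ia) !ler_pM2r ?(inner_gt0 ia)// => -> ->.
have -> : sup (eigenvalues T) = M.
  apply/eqP; rewrite eq_le; apply/andP; split.
    by apply: ge_sup => [|l /ev_bnd /andP[]//]; exists M.
  by apply: ub_le_sup => //; exists M => l /ev_bnd /andP[].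
have -> : inf (eigenvalues T) = m.
  apply/eqP; rewrite eq_le; apply/andP; split.
    by apply: ge_inf => //; exists m => l /ev_bnd /andP[].
  by apply: lb_le_inf => [|l /ev_bnd /andP[]//]; exists m.
by [].
Qed.

(** Rescaling a polynomial to be 1 at 0 makes it the error polynomial of a
    competitor of the iterate. *)
Lemma krylov_affine_error T u u0 k c v : c != 0 ->
  krylov T (u - u0) k c v ->
  exists2 w, krylov_affine T u u0 k w & u - w = c^-1 *: v.
Proof.
move=> c0 [b vE]; exists (u - c^-1 *: v); last by rewrite opprB addrC subrK.
exists (fun j => - (c^-1 * b j)).
rewrite vE scalerDr scalerA mulVf// scale1r opprD opprB addrA.
rewrite [u + (u0 - u)]addrC subrK; congr (_ + _).
rewrite scaler_sumr -sumrN; apply: eq_bigr => j _.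
by rewrite scaleNr scalerA.
Qed.

(** With [m] and [M] the extreme eigenvalues, [Z = z - t T] maps [m] and [M]
    to [r] and [- r], where [r] is the convergence rate. So [|Z w| <= r |w|],
    the Chebyshev vector of [Z] has norm at most [r ^+ k |u - u0|] by the Pell
    identity, and its polynomial is at least [1 / 2] at 0. *)
Lemma conjugate_gradient_rate n (e : 'I_n -> V) T u u0 k uk :
  finite_basis e -> selfadjoint a T -> (forall v, v != 0 -> 0 < a (T v) v) ->
  pcg_iterate a T u u0 k uk ->
  form_norm a (u - uk) <= 2 * ((Num.sqrt (condition_number T) - 1) /
     (Num.sqrt (condition_number T) + 1)) ^+ k * form_norm a (u - u0).
Proof.
move=> be aT Tpos [_ ukmin].
have [e0|eN0] := eqVneq (u - u0) 0.
  have k0 : krylov_affine T u u0 k u0.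
    exists (fun=> 0); rewrite big1 ?addr0// => j _.
    by rewrite scale0r.
  apply: le_trans (ukmin _ k0) _.
  by rewrite e0 /form_norm (inner0l ia) sqrtr0 mulr0.
have [[x xN0 TxE] ge_m le_M] :=
  extreme_eigenvalues be aT (ex_intro (fun v : V => v != 0) _ eN0).
rewrite /condition_number.
set m := inf _ in TxE ge_m *; set M := sup _ in le_M *.
have m0 : 0 < m.
  by have := Tpos _ xN0; rewrite TxE (innerZl ia) pmulr_lgt0// (inner_gt0 ia).
have mM : m <= M.
  rewrite -(ler_pM2r (inner_gt0 ia xN0)); exact: le_trans (ge_m x) (le_M x).
have M0 : 0 < M := lt_le_trans m0 mM.
set p := Num.sqrt m; set q := Num.sqrt M.
have p0 : 0 < p by rewrite sqrtr_gt0.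
have q0 : 0 < q by rewrite sqrtr_gt0.
have pq : p <= q by apply: ler_wsqrtr.
have mE : m = p ^+ 2 by rewrite sqr_sqrtr// ltW.
have ME : M = q ^+ 2 by rewrite sqr_sqrtr// ltW.
have pN0 : p != 0 by rewrite gt_eqF.
have pqN0 : p + q != 0 by rewrite gt_eqF// addr_gt0.
have -> : Num.sqrt (M / m) = q / p by rewrite sqrtrM ?(ltW M0)// sqrtrV// ltW.
have -> : (q / p - 1) / (q / p + 1) = (q - p) / (p + q).
  by field; rewrite pqN0 pN0.
set r := (q - p) / (p + q).
have r0 : 0 <= r by rewrite divr_ge0 ?subr_ge0 ?addr_ge0 ?(ltW p0) ?(ltW q0).
pose z := (1 + r ^+ 2) / 2; pose t := 2 / (p + q) ^+ 2.
have t0 : 0 <= t by rewrite divr_ge0 ?sqr_ge0.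
have zm : z - t * m = r by rewrite /z /t mE /r; field.
have zM : z - t * M = - r by rewrite /z /t ME /r; field.
pose Z v := z *: v - t *: T v.
have aZ : selfadjoint a Z := selfadjoint_shift ia aT z t.
have Zr w : `|a (Z w) w| <= r * a w w.
  rewrite /Z !(innerE ia) ler_norml.
  have := ler_wpM2l t0 (ge_m w); have := ler_wpM2l t0 (le_M w).
  have : (z - t * m) * a w w = r * a w w by rewrite zm.
  have : (z - t * M) * a w w = - r * a w w by rewrite zM.
  by move=> h1 h2 h3 h4; apply/andP; split; lra.
have [s [w [sigma [omega [ks _ s1 s2 sq]]]]] :=
  chebyshev_pair ia (u - u0) aT t k (erefl z).
have rk : 0 <= r ^+ 2 ^+ k by rewrite exprn_ge0// sqr_ge0.
have sig : 1 <= 2 * sigma by lra.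
have sig0 : 0 < sigma by lra.
have sle : form_norm a s <= r ^+ k * form_norm a (u - u0).
  rewrite -(@ler_pXn2r _ 2) ?nnegrE ?mulr_ge0 ?exprn_ge0 ?sqrtr_ge0//.
  rewrite exprMn !form_norm_sqr// exprAC -sq -addrA lerDl subr_ge0.
  exact: (selfadjoint_normr_le ia aZ r0 Zr w).
have [v kv vE] := krylov_affine_error (lt0r_neq0 sig0) ks.
apply: le_trans (ukmin _ kv) _; rewrite vE form_normZ//.
rewrite ger0_norm ?invr_ge0 ?(ltW sig0)// [leLHS]mulrC ler_pdivrMr//.
apply: le_trans sle _.
have -> : 2 * r ^+ k * form_norm a (u - u0) * sigma =
    2 * sigma * (r ^+ k * form_norm a (u - u0)) by ring.
by apply: ler_peMl => //; rewrite mulr_ge0 ?exprn_ge0// sqrtr_ge0.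
Qed.

End conjugate_gradient.

(** * Null sets and boxes *)

Section null_sets.
Local Open Scope ereal_scope.
Import HBNNSimple.

Lemma ge0_integral_setD_null d (T : measurableType d) (R : realType)
    (mu : {measure set T -> \bar R}) (D N : set T) (f : T -> \bar R) :
  measurable N -> mu N = 0 -> (forall x, 0 <= f x) ->
  \int[mu]_(x in D) f x = \int[mu]_(x in D `\` N) f x.
Proof.
move=> mN N0 f0; rewrite !ge0_integralE//.
apply/eqP; rewrite eq_le; apply/andP; split; last first.
  apply: le_ereal_sup => _ [h /= hf <-]; exists h => //= x.
  apply: le_trans (hf x) _; rewrite !patchE.
  case: ifPn => [/set_mem [xD _]|_]; first by rewrite mem_set.
  by case: ifPn.
apply: ge_ereal_sup => _ [h /= hf <-].
pose g := proj_nnsfun h (measurableC mN).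
have gE : g =1 h \_ (~` N) by move=> x; rewrite (mrestrict h (measurableC mN)).
apply: ereal_sup_ubound; exists g.
  rewrite /mkset => x; have := hf x; rewrite gE !patchE.
  have [xN _|xN] := pselect (N x).
    by rewrite (@memNset _ (~` N)) => [|/(_ xN)//]; case: ifPn.
  rewrite (@mem_set _ (~` N))// (_ : (x \in D `\` N) = (x \in D))//.
  by apply/idP/idP => /set_mem => [[/mem_set]//|xD]; apply/mem_set.
rewrite (eq_sintegral _ _ gE) -integral_nnsfun; last exact: measurableC.
have <- : \int[mu]_x (h x)%:E = sintegral mu h.
  by rewrite integral_nnsfun// patch_setT.
rewrite [RHS](ge0_negligible_integral mN)//.
- by rewrite setTD.
- exact/measurable_EFinP.
- by move=> x _; rewrite lee_fin.
Qed.

(** Removing a null set does not change the integral of any function: a simple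
    function below the integrand can be set to zero on the null set. This is
    needed because a derivative may fail to be measurable on the mesh faces. *)
Lemma integral_setD_null d (T : measurableType d) (R : realType)
    (mu : {measure set T -> \bar R}) (D N : set T) (f : T -> \bar R) :
  measurable N -> mu N = 0 ->
  \int[mu]_(x in D) f x = \int[mu]_(x in D `\` N) f x.
Proof.
move=> mN N0; rewrite [LHS]integralE [RHS]integralE.
by rewrite !(ge0_integral_setD_null D mN N0).
Qed.

End null_sets.

Section boxes.
Context {R : realType}.

Definition box d (E : 'I_d -> set (measurableTypeR R)) : set 'rV[R]_d :=
  [set x | forall i, E i (x 0 i)].

Lemma measurable_box d (E : 'I_d -> set (measurableTypeR R)) :
  (forall i, measurable (E i)) -> measurable (box E).
Proof.
move=> mE.
have -> : box E =
    \bigcap_(i in [set: 'I_d]) ((fun x : 'rV[R]_d => x 0 i) @^-1` E i).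
  by apply/seteqP; split => x /= h i; [move=> _|]; apply: h.
apply: fin_bigcap_measurable => // i _.
by rewrite -[X in measurable X]setTI; apply: measurable_rV_coord.
Qed.

(** With factors that are points or the whole line this shows that hyperplanes
    are null, and with open intervals that open boxes are not. *)
Lemma lebesgue_rV_box d (E : 'I_d -> set (measurableTypeR R)) :
  (forall i, measurable (E i)) ->
  lebesgue_rV d (box E) =
  (\prod_(i < d) lebesgue_measure (E i))%E.
Proof.
elim: d E => [|d IH] E mE.
  rewrite big_ord0 (_ : box E = setT); first by rewrite /= diracT.
  by apply/seteqP; split => // x _ [].
rewrite big_ord_recl -IH//= /lebesgue_rV_step /pushforward.
rewrite (_ : _ @^-1` _ = E ord0 `*` box (fun i => E (lift ord0 i))).
  by rewrite product_measure1E//; exact: measurable_box.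
apply/seteqP; split => -[t x] /=.
  move=> h; split; first by have := h ord0; rewrite rV_consE0.
  by move=> i; have := h (lift ord0 i); rewrite rV_consES.
move=> [Et Ex] i; have [j ->|->] := unliftP ord0 i.
  by rewrite rV_consES; exact: Ex.
by rewrite rV_consE0.
Qed.

End boxes.

(** * Cells and faces of the mesh *)

Section mesh.
Context {R : realType}.

Lemma measurable_unit_cube d : measurable (@unit_cube R d).
Proof.
rewrite (_ : unit_cube d = box (fun=> `[0, 1]%classic)).
  by apply: measurable_box => i; exact: measurable_itv.
by apply/seteqP; split => x /= h i; have := h i; rewrite /= in_itv.
Qed.

Lemma lebesgue_rV_unit_cube d : (lebesgue_rV d (@unit_cube R d) < +oo)%E.
Proof.
rewrite (_ : unit_cube d = box (fun=> `[0, 1]%classic)).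
  rewrite lebesgue_rV_box => [|i]; last exact: measurable_itv.
  rewrite big1 ?ltry// => i _.
  by rewrite lebesgue_measure_itv/= lte_fin ltr01 oppr0 adde0.
by apply/seteqP; split => x /= h i; have := h i; rewrite /= in_itv.
Qed.

Lemma lebesgue_rV_hyperplane d (i : 'I_d) (c : R) :
  measurable [set x : 'rV[R]_d | x 0 i = c] /\
  lebesgue_rV d [set x : 'rV[R]_d | x 0 i = c] = 0%E.
Proof.
pose E (j : 'I_d) : set (measurableTypeR R) := if j == i then [set c] else setT.
have mE j : measurable (E j) by rewrite /E; case: ifP.
have -> : [set x : 'rV[R]_d | x 0 i = c] = box E.
  apply/seteqP; split => x /=; last by move/(_ i); rewrite /E eqxx.
  by move=> xc j; rewrite /E; case: eqP => [->|].
split; first exact: measurable_box.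
rewrite lebesgue_rV_box// (bigD1 i)//= {1}/E eqxx.
by rewrite lebesgue_measure_set1 mul0e.
Qed.

Lemma lebesgue_rV_open_box_gt0 d (lo hi : 'I_d -> R) :
  (forall i, lo i < hi i) ->
  (0 < lebesgue_rV d (box (fun i => `]lo i, hi i[%classic)))%E.
Proof.
move=> lohi; rewrite lebesgue_rV_box => [|i]; last exact: measurable_itv.
elim/big_ind: _ => //= [x y|i _]; first exact: mule_gt0.
by rewrite lebesgue_measure_itv/= lte_fin lohi EFinN lte_fin subr_gt0.
Qed.

Context {d N : nat}.
Hypothesis N0 : (0 < N)%N.
Implicit Types (k : {ffun 'I_d -> 'I_N}) (x : 'rV[R]_d).

Let NR0 : 0 < N%:R :> R. Proof. by rewrite ltr0n. Qed.

Lemma unit_cube_mesh_cell x : unit_cube d x -> exists k, @mesh_cell R d N k x.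
Proof.
move=> xD.
have pick i : exists j : 'I_N, j%:R / N%:R <= x 0 i <= j.+1%:R / N%:R.
  have /andP[x0 x1] := xD i.
  have [x1'|x1'] := ltP (x 0 i) 1; last first.
    have N1 : (N.-1 < N)%N by rewrite prednK.
    (* The last cell contains the points with [x 0 i = 1]. *)
    exists (Ordinal N1) => /=; rewrite prednK// divff ?gt_eqF// x1 andbT.
    by apply: le_trans x1'; rewrite ler_pdivrMr// mul1r ler_nat leq_pred.
  have xN : 0 <= x 0 i * N%:R by rewrite mulr_ge0.
  have /andP[t1 t2] := truncn_itv xN.
  have tN : (Num.truncn (x 0 i * N%:R)%R < N)%N.
    by rewrite -(ltr_nat R); apply: le_lt_trans t1 _; rewrite gtr_pMl.
  by exists (Ordinal tN); rewrite /= ler_pdivrMr// t1/= ler_pdivlMr// ltW.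
exists [ffun i => projT1 (cid (pick i))] => i.
by rewrite ffunE; case: cid.
Qed.

Definition mesh_faces : set 'rV[R]_d :=
  \bigcup_(p in [set: 'I_d * 'I_N.+1]) [set x | x 0 p.1 = p.2%:R / N%:R].

Lemma mesh_faces_null : measurable mesh_faces /\ lebesgue_rV d mesh_faces = 0%E.
Proof.
have -> : mesh_faces = \big[setU/set0]_(p : 'I_d * 'I_N.+1)
    [set x | x 0 p.1 = p.2%:R / N%:R].
  rewrite -bigcup_seq; congr bigcup.
  by apply/seteqP; split => // p _; exact: mem_index_enum.
elim/big_ind: _ => [|A B [mA A0] [mB B0]|p _].
  by split; [exact: measurable0|exact: measure0].
  by rewrite measureU0//; split => //; exact: measurableU.
exact: lebesgue_rV_hyperplane.
Qed.

Definition open_cell k : set 'rV[R]_d :=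
  box (fun i => `](k i)%:R / N%:R, (k i).+1%:R / N%:R[%classic).

Lemma open_cell_sub k : open_cell k `<=` mesh_cell k.
Proof.
by move=> x h i; have := h i; rewrite /= in_itv/= => /andP[/ltW -> /ltW ->].
Qed.

Lemma mesh_cell_sub k : @mesh_cell R d N k `<=` unit_cube d.
Proof.
move=> x h i; have /andP[h1 h2] := h i.
rewrite (le_trans _ h1) ?divr_ge0//= (le_trans h2)//.
by rewrite ler_pdivrMr// mul1r ler_nat.
Qed.

Lemma mesh_cell_open k x : mesh_cell k x -> ~ mesh_faces x -> open_cell k x.
Proof.
move=> kx xF i; rewrite /= in_itv/=.
have /andP[h1 h2] := kx i; rewrite !lt_def h1 h2 !andbT.
apply/andP; split; apply/eqP => xE; apply: xF.
  by exists (i, widen_ord (leqnSn _) (k i)).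
by exists (i, lift ord0 (k i)).
Qed.

Lemma interior_open_cell x : unit_cube d x -> ~ mesh_faces x ->
  exists k, open_cell k x.
Proof.
move=> /unit_cube_mesh_cell[k kx] xF; exists k; exact: mesh_cell_open.
Qed.

Lemma open_cell_near k x : open_cell k x -> \forall y \near x, open_cell k y.
Proof.
pose I i := `](k i)%:R / N%:R, (k i).+1%:R / N%:R[%classic : set R.
move=> kx; apply: (filter_forall (f := fun i (y : 'rV[R]_d) => I i (y 0 i))
  (F := nbhs x)) => i.
have : nbhs (x 0 i) (I i).
  by apply: open_nbhs_nbhs; split; [exact: interval_open|exact: kx].
exact: (@coord_continuous R 1 d 0 i x).
Qed.

Lemma measurable_open_cell k : measurable (open_cell k).
Proof. by apply: measurable_box => i; exact: measurable_itv. Qed.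

End mesh.

(** * Derivatives of multilinear functions *)

Section multilinear.
Context {R : realType} {d : nat}.
Implicit Types (c : {set 'I_d} -> R) (x : 'rV[R]_d) (i : 'I_d).

Definition multilinear_deriv c i x : R :=
  \sum_(S : {set 'I_d} | i \in S) c S * \prod_(j in S :\ i) x 0 j.

(** A multilinear function is affine in each coordinate. *)
Lemma multilinear_shift c i h x :
  multilinear c (h *: delta_mx 0 i + x) =
  multilinear c x + h * multilinear_deriv c i x.
Proof.
rewrite /multilinear /multilinear_deriv.
rewrite [X in X = _](bigID (fun S : {set 'I_d} => i \in S))/=.
rewrite [X in _ = X + _](bigID (fun S : {set 'I_d} => i \in S))/=.
rewrite addrAC; congr (_ + _); last first.
  apply: eq_bigr => S iS; congr (_ * _); apply: eq_bigr => j jS.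
  by rewrite !mxE eqxx (negbTE (memPn iS j jS)) mulr0 add0r.
rewrite mulr_sumr -big_split/=; apply: eq_bigr => S iS.
rewrite (big_setD1 i iS)/= [in RHS](big_setD1 i iS)/=.
rewrite (eq_bigr (fun j => x 0 j)) => [|j /setD1P[ji _]].
  by rewrite !mxE !eqxx mulr1; ring.
by rewrite !mxE eqxx (negbTE ji) mulr0 add0r.
Qed.

Lemma multilinear_derivP a c e i x :
  multilinear_deriv (fun S => a * c S + e S) i x =
  a * multilinear_deriv c i x + multilinear_deriv e i x.
Proof.
rewrite /multilinear_deriv mulr_sumr -big_split/=.
by apply: eq_bigr => S _; rewrite mulrDl mulrA.
Qed.

Lemma multilinear_deriv_le c i x : unit_cube d x ->
  `|multilinear_deriv c i x| <= \sum_S `|c S|.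
Proof.
move=> xD; apply: le_trans (ler_norm_sum _ _ _) _.
rewrite [leRHS](bigID (fun S : {set 'I_d} => i \in S))/=.
apply: ler_wpDr; first exact: sumr_ge0.
apply: ler_sum => S _; rewrite normrM; apply: ler_piMr => //.
have : 0 <= \prod_(j in S :\ i) x 0 j <= 1.
  elim/big_ind: _ => [|y z /andP[y0 y1] /andP[z0 z1]|j _]; last exact: xD.
    by rewrite ler01 lexx.
  by rewrite mulr_ge0//= mulr_ile1.
by move=> /andP[p0 p1]; rewrite ger0_norm.
Qed.

Lemma measurable_multilinear_deriv c i (D : set 'rV[R]_d) :
  measurable_fun D (multilinear_deriv c i).
Proof.
rewrite (_ : multilinear_deriv c i = fun x : 'rV[R]_d =>
    \sum_(S <- [seq S : {set 'I_d} <- index_enum _ | i \in S])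
       c S * \prod_(j <- [seq j <- index_enum _ | j \in S :\ i]) x 0 j).
  apply: measurable_funTS; apply: measurable_sum => S.
  apply: measurable_funM => //; apply: measurable_prod => j _.
  exact: measurable_rV_coord.
apply/funext => x; rewrite big_filter; apply: eq_bigr => S _.
by rewrite big_filter.
Qed.

Lemma continuous_multilinear_deriv c i : continuous (multilinear_deriv c i).
Proof.
rewrite /multilinear_deriv.
apply: continuous_big; first exact: add_continuous.
move=> S _ x.
apply: (@continuousM R _ (fun=> c S)); first exact: cst_continuous.
apply: (@continuous_big R _ _ _ _ (@mul_continuous R) _ _
  (fun j (x : 'rV[R]_d) => x 0 j)).
by move=> j _; exact: coord_continuous.
Qed.

Lemma derive_multilinear c i x :
  'D_(delta_mx 0 i) (multilinear c) x = multilinear_deriv c i x.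
Proof.
rewrite /derive; apply: cvg_lim => //; apply: cvg_near_cst.
near=> h; rewrite /= multilinear_shift [_ + _ * _]addrC addrK.
rewrite /GRing.scale/= mulrA mulVf ?mul1r//.
near: h; exact: nbhs_dnbhs_neq.
Unshelve. all: by end_near. Qed.

Lemma derive_open_cell N (v : 'rV[R]_d -> R) c (k : {ffun 'I_d -> 'I_N}) i x :
  (forall y, mesh_cell k y -> v y = multilinear c y) -> open_cell k x ->
  'D_(delta_mx 0 i) v x = multilinear_deriv c i x.
Proof.
move=> vE kx; rewrite -derive_multilinear; apply: near_eq_derive.
by apply: filterS (open_cell_near kx) => y /open_cell_sub/vE.
Qed.

End multilinear.

(** * Gradients of finite element functions *)

Section Q1_gradient.
Context {R : realType} {d N : nat}.
Hypothesis N0 : (0 < N)%N.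
Implicit Types (u v : Q1_space R d N) (x : 'rV[R]_d).

Lemma Q1_spaceP u :
  [/\ continuous u, forall x, ~ unit_cube d x -> u x = 0 &
      forall k : {ffun 'I_d -> 'I_N},
        exists c, forall x, mesh_cell k x -> u x = multilinear c x].
Proof. by apply/asboolP; exact: (valP u). Qed.

Lemma Q1_valP (a : R) u v x : (a *: u + v) x = a * u x + v x.
Proof. by []. Qed.

Definition Q1_coef u (k : {ffun 'I_d -> 'I_N}) : {set 'I_d} -> R :=
  let: And3 _ _ uQ := Q1_spaceP u in projT1 (cid (uQ k)).

Lemma Q1_coefP u (k : {ffun 'I_d -> 'I_N}) x :
  mesh_cell k x -> u x = multilinear (Q1_coef u k) x.
Proof.
rewrite /Q1_coef; case: (Q1_spaceP u) => _ _ uQ.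
by case: cid => c /= cP; exact: cP.
Qed.

Lemma Q1_derive u (k : {ffun 'I_d -> 'I_N}) i x : open_cell k x ->
  'D_(delta_mx 0 i) u x = multilinear_deriv (Q1_coef u k) i x.
Proof. by apply: derive_open_cell => y; exact: Q1_coefP. Qed.

(* On such a domain every derivative below is that of a multilinear function. *)
Variable D : set 'rV[R]_d.
Hypotheses (mD : measurable D)
  (DI : D `<=` unit_cube d `\` @mesh_faces R d N).

Let cell x : D x -> exists k, @open_cell R d N k x.
Proof. by move=> /DI[xD xF]; exact: interior_open_cell. Qed.

Lemma Q1_derive_linear a u v i x : D x ->
  'D_(delta_mx 0 i) (a *: u + v : Q1_space R d N) x =
  a * 'D_(delta_mx 0 i) u x + 'D_(delta_mx 0 i) v x.
Proof.
move=> /cell[k kx].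
rewrite (Q1_derive u _ kx) (Q1_derive v _ kx) -multilinear_derivP.
apply: (@derive_open_cell _ _ N (a *: u + v : Q1_space R d N) _ k i x _ kx).
move=> y ky.
rewrite Q1_valP !(Q1_coefP _ ky) /multilinear mulr_sumr -big_split/=.
by apply: eq_bigr => S _; rewrite mulrDl mulrA.
Qed.

Lemma Q1_derive_bounded u i : exists K, forall x, D x ->
  `|'D_(delta_mx 0 i) u x| <= K.
Proof.
exists (\sum_k \sum_S `|Q1_coef u k S|) => x Dx.
have [k kx] := cell Dx; rewrite (Q1_derive _ _ kx).
apply: le_trans (multilinear_deriv_le _ _ _) _; first by have [] := DI Dx.
rewrite [leRHS](bigD1 k)//= lerDl; apply: sumr_ge0 => l _.
exact: sumr_ge0.
Qed.

Lemma measurable_Q1_derive u i :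
  measurable_fun D (fun x => 'D_(delta_mx 0 i) u x).
Proof.
move=> _ Y mY.
rewrite (_ : _ `&` _ = \bigcup_(k in [set: {ffun 'I_d -> 'I_N}])
   (D `&` (open_cell k `&` multilinear_deriv (Q1_coef u k) i @^-1` Y))).
  apply: fin_bigcup_measurable => // k _; apply: measurableI => //.
  have mC := @measurable_open_cell R d N k.
  exact: (measurable_multilinear_deriv (Q1_coef u k) i mC).
apply/seteqP; split => x /=.
  move=> [Dx Yx]; have [k kx] := cell Dx.
  exists k => //=; split=> //; split=> //.
  by rewrite -(Q1_derive _ _ kx).
by move=> [k _ [Dx [kx Yx]]]; split=> //; rewrite (Q1_derive _ _ kx).
Qed.

End Q1_gradient.

(** * Functions with a vanishing partial derivative *)

Section Q1_definite.
Context {R : realType} {d N : nat}.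
Hypothesis N0 : (0 < N)%N.
Implicit Types (u v : Q1_space R d N) (x : 'rV[R]_d).

Let NR0 : 0 < N%:R :> R. Proof. by rewrite ltr0n. Qed.

Lemma near_rV_box (x : 'rV[R]_d) (P : set 'rV[R]_d) :
  (\forall y \near x, P y) ->
  exists2 e : R, 0 < e &
    forall y : 'rV[R]_d, (forall i, `|x 0 i - y 0 i| < e) -> P y.
Proof.
move=> /nbhs_ballP[e /= e0 xP]; exists e => // y xy; apply: xP.
by split => // i j; rewrite ord1; exact: xy.
Qed.

(** The points of the cell that are close to [x] contain a nonempty open box,
    which no null set contains. *)
Lemma mesh_cell_dense (k : {ffun 'I_d -> 'I_N}) (Z P : set 'rV[R]_d) x :
  measurable Z -> lebesgue_rV d Z = 0%E -> mesh_cell k x ->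
  (\forall y \near x, P y) -> exists y, [/\ mesh_cell k y, ~ Z y & P y].
Proof.
move=> mZ Z0 kx /near_rV_box[e e0 xP].
pose lo i := Num.max (x 0 i - e) ((k i)%:R / N%:R).
pose hi i := Num.min (x 0 i + e) ((k i).+1%:R / N%:R).
have lohi i : lo i < hi i.
  have /andP[x1 x2] := kx i.
  have kk : (k i)%:R / N%:R < (k i).+1%:R / N%:R :> R.
    by rewrite ltr_pM2r ?invr_gt0// ltr_nat.
  by rewrite /lo /hi gt_max !lt_min; do ![apply/andP; split]; lra.
apply: contrapT => no.
have := lebesgue_rV_open_box_gt0 lohi; set B := box _ => B0.
suff BZ : B `<=` Z.
  move: B0; rewrite (subset_measure0 _ mZ BZ Z0) ?ltxx//.
  by apply: measurable_box => i; exact: measurable_itv.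
move=> y By; apply: contrapT => yZ; apply: no; exists y; split=> //.
  move=> i; have := By i; rewrite /= in_itv/= gt_max lt_min.
  by move=> /andP[/andP[_ /ltW->] /andP[_ /ltW->]].
apply: xP => i; have := By i; rewrite /= in_itv/= gt_max lt_min.
by move=> /andP[/andP[h1 _] /andP[h2 _]]; rewrite ltr_norml; lra.
Qed.

(** A continuous function that vanishes on a dense subset of a cell vanishes
    on the closed cell. *)
Lemma Q1_derive_null u (i : 'I_d) (Z : set 'rV[R]_d) :
  measurable Z -> lebesgue_rV d Z = 0%E ->
  (forall x, unit_cube d x -> ~ Z x -> 'D_(delta_mx 0 i) u x = 0) ->
  forall k x, mesh_cell k x -> multilinear_deriv (Q1_coef u k) i x = 0.
Proof.
move=> mZ Z0 uZ k x kx; apply: contrapT => /eqP b0.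
have [mF F0] := @mesh_faces_null R d N.
have [] := @mesh_cell_dense k (Z `|` @mesh_faces R d N)
  [set y | multilinear_deriv (Q1_coef u k) i y != 0] x _ _ kx.
- exact: measurableU.
- by rewrite measureU0.
- have := @continuous_multilinear_deriv R d (Q1_coef u k) i x.
  move=> /(_ [set t | t != 0]); apply.
  by apply: open_nbhs_nbhs; split => //; exact: open_neq.
move=> y [ky yZF] /= /negP; apply; apply/eqP; rewrite -(@Q1_derive _ _ _ u k).
  by apply: uZ => [|yZ]; [exact: mesh_cell_sub ky|apply: yZF; left].
by apply: mesh_cell_open => // yF; apply: yZF; right.
Qed.

(** Along a line in direction [i] the function is constant on each cell, and
    it vanishes where the line enters the cube. *)
Lemma Q1_eq0 u (i : 'I_d) (Z : set 'rV[R]_d) :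
  measurable Z -> lebesgue_rV d Z = 0%E ->
  (forall x, unit_cube d x -> ~ Z x -> 'D_(delta_mx 0 i) u x = 0) -> u = 0.
Proof.
move=> mZ Z0 uZ; have u_der := Q1_derive_null mZ Z0 uZ.
have [uC u_out uQ] := Q1_spaceP u.
apply/val_inj/funext => x /=.
have [xD|/u_out//] := pselect (unit_cube d x).
have [l lx] := unit_cube_mesh_cell N0 xD.
(* The projection of [x] to the face of the cube where coordinate [i] is 0. *)
pose w : 'rV[R]_d := x - x 0 i *: delta_mx 0 i.
have wi t : (t *: delta_mx 0 i + w) 0 i = t.
  by rewrite !mxE !eqxx !mulr1 subrr addr0.
have wj t j : j != i -> (t *: delta_mx 0 i + w) 0 j = x 0 j.
  by move=> ji; rewrite !mxE eqxx (negbTE ji) !mulr0 subr0 add0r.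
pose k (j : 'I_N) := [ffun j' => if j' == i then j else l j'].
have in_cell (j : 'I_N) (t : R) : j%:R / N%:R <= t <= j.+1%:R / N%:R ->
    mesh_cell (k j) (t *: delta_mx 0 i + w).
  move=> jt j'; rewrite ffunE; have [->|ji] := eqVneq j' i; first by rewrite wi.
  by rewrite wj//; exact: lx.
have jj (j : 'I_N) : j%:R / N%:R <= j.+1%:R / N%:R :> R.
  by rewrite ler_pM2r ?invr_gt0// ler_nat.
have step (j : 'I_N) (t : R) : j%:R / N%:R <= t <= j.+1%:R / N%:R ->
    u (t *: delta_mx 0 i + w) = u ((j%:R / N%:R) *: delta_mx 0 i + w).
  move=> jt; have jc : mesh_cell (k j) ((j%:R / N%:R) *: delta_mx 0 i + w).
    by apply: in_cell; rewrite lexx jj.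
  rewrite (Q1_coefP u (in_cell _ _ jt)) (Q1_coefP u jc).
  rewrite -{1}[t](subrK (j%:R / N%:R)) scalerDl -addrA multilinear_shift.
  by rewrite u_der ?mulr0 ?addr0//; exact: jc.
(* Just outside the face where coordinate [i] is 0 the function is 0. *)
have u0 : u (0 *: delta_mx 0 i + w) = 0.
  apply: contrapT => /eqP uN0.
  have : \forall y \near (0 *: delta_mx 0 i + w), u y != 0.
    have := uC (0 *: delta_mx 0 i + w).
    move=> /(_ [set t | t != 0]); apply.
    by apply: open_nbhs_nbhs; split => //; exact: open_neq.
  move=> /near_rV_box[e e0 /(_ (- (e / 2) *: delta_mx 0 i + w))].
  have -> : u (- (e / 2) *: delta_mx 0 i + w) = 0.
    by apply: u_out => /(_ i); rewrite wi; lra.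
  rewrite eqxx => h; suff : false by []; apply: h => j.
  have [->|ji] := eqVneq j i; first by rewrite !wi sub0r opprK gtr0_norm; lra.
  by rewrite !wj// subrr normr0.
have uj (j : nat) : (j <= N)%N -> u ((j%:R / N%:R) *: delta_mx 0 i + w) = 0.
  elim: j => [_|j IH jN]; first by rewrite mul0r.
  rewrite -(IH (ltnW jN)); apply: (step (Ordinal jN)) => /=.
  by rewrite lexx andbT; exact: (jj (Ordinal jN)).
have -> : x = x 0 i *: delta_mx 0 i + w by rewrite addrC subrK.
by rewrite (step (l i)) ?uj// ltnW.
Qed.

End Q1_definite.

(** * The energy is an inner product *)

Section Q1_energy.
Context {R : realType} {d N : nat}.
Hypothesis N0 : (0 < N)%N.
Implicit Types (u v : Q1_space R d N) (x : 'rV[R]_d).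

Lemma energyC D (A f g : 'rV[R]_d -> R) : energy D A f g = energy D A g f.
Proof.
rewrite /energy; congr Rintegral; apply/funext => x; congr (_ * _).
by apply: eq_bigr => i _; rewrite mulrC.
Qed.

Lemma grad_dot_ge0 (f : 'rV[R]_d -> R) x : 0 <= grad_dot f f x.
Proof. by apply: sumr_ge0 => i _; rewrite -expr2 sqr_ge0. Qed.

Variables (A : 'rV[R]_d -> R) (alpha beta : R).
Hypotheses (mA : measurable_fun (unit_cube d) A) (alpha0 : 0 < alpha).

Section domain.
Variable D : set 'rV[R]_d.
Hypotheses (mD : measurable D)
  (DI : D `<=` unit_cube d `\` @mesh_faces R d N).
Hypothesis DA : forall x, D x -> alpha <= A x <= beta.

Lemma integrable_energy u v : (lebesgue_rV d).-integrable D
  (EFin \o (fun x => A x * grad_dot u v x)).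
Proof.
have Dcube : D `<=` unit_cube d by move=> x /DI[].
have mcube := @measurable_unit_cube R d.
have mg := measurable_Q1_derive N0 mD DI.
apply: measurable_bounded_integrable => //.
- apply: le_lt_trans (lebesgue_rV_unit_cube d).
  by apply: le_measure => //; rewrite inE.
- apply: measurable_funM; first exact: measurable_funS mcube Dcube mA.
  apply: measurable_sum => i; apply: measurable_funM; exact: mg.
- have bnd w i := cid (Q1_derive_bounded N0 DI w i).
  pose K w i := projT1 (bnd w i).
  have KP (w : Q1_space R d N) i x : D x -> `|'D_(delta_mx 0 i) w x| <= K w i.
    by move=> Dx; exact: (projT2 (bnd w i)) x Dx.
  exists (beta * \sum_i K u i * K v i).
  split => [|M ltM x Dx]; first exact: num_real.
  apply: le_trans (ltW ltM); rewrite normrM.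
  have /andP[a1 a2] := DA Dx.
  apply: ler_pM => //; first by rewrite ger0_norm// (le_trans _ a1)// ltW.
  apply: le_trans (ler_norm_sum _ _ _) _; apply: ler_sum => i _.
  by rewrite normrM; apply: ler_pM => //; exact: KP.
Qed.

Lemma energy_linear u : scalar (fun v : Q1_space R d N => energy D A u v).
Proof.
move=> c v w; rewrite /energy.
have iv := integrable_energy u v; have iw := integrable_energy u w.
rewrite -RintegralZl// -RintegralD//; last first.
  have := integrableZl mD c iv; congr (_.-integrable _ _).
apply: eq_Rintegral => x /set_mem Dx.
rewrite /grad_dot [in RHS]mulrCA -mulrDr.
rewrite [X in _ = _ * (X + _)]mulr_sumr -big_split/=; congr (_ * _).
apply: eq_bigr => i _; rewrite (Q1_derive_linear N0 DI)//.
by rewrite mulrDr mulrCA.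
Qed.

Lemma energy_ge0 u : 0 <= energy D A u u.
Proof.
apply: Rintegral_ge0 => x Dx; have /andP[a1 _] := DA Dx.
apply: mulr_ge0; [exact: le_trans (ltW alpha0) a1|exact: grad_dot_ge0].
Qed.

Lemma energy_eq0 u : energy D A u u = 0 -> exists Z, [/\ measurable Z,
  lebesgue_rV d Z = 0%E & forall x, D x -> ~ Z x ->
  forall i, 'D_(delta_mx 0 i) u x = 0].
Proof.
have iu := integrable_energy u u => Iu0.
have ge0 x : D x -> 0 <= A x * grad_dot u u x.
  move=> Dx; have /andP[a1 _] := DA Dx.
  apply: mulr_ge0; [exact: le_trans (ltW alpha0) a1|exact: grad_dot_ge0].
have I0 : (\int[lebesgue_rV d]_(x in D) `|(A x * grad_dot u u x)%:E| = 0)%E.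
  rewrite (eq_integral (fun x => (A x * grad_dot u u x)%:E)); last first.
    by move=> x /set_mem Dx; rewrite /= ger0_norm// ge0.
  by rewrite -[LHS]fineK ?[fine _]Iu0//; exact: integrable_fin_num iu.
have /(ae_eq_integral_abs _ mD) [|Z [mZ Z0 ZP]] := I0.
  exact: measurable_int iu.
exists Z; split=> // x Dx Zx i.
have : A x * grad_dot u u x = 0.
  by apply: contrapT => h; apply: Zx; apply: ZP => /= /(_ Dx) [].
have /andP[a1 _] := DA Dx.
move/eqP; rewrite mulf_eq0 gt_eqF ?(lt_le_trans alpha0)//=.
rewrite /grad_dot psumr_eq0 => [/allP/(_ i)|j _]; last first.
  by rewrite -expr2 sqr_ge0.
by rewrite mem_index_enum => /(_ isT)/=; rewrite mulf_eq0 orbb => /eqP.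
Qed.

End domain.

Hypothesis d0 : (0 < d)%N.
Hypothesis bndA :
  {ae lebesgue_rV d, forall x, unit_cube d x -> alpha <= A x <= beta}.

(** The mesh faces and the points where the coefficient is out of bounds form
    a null set, so the energy is an integral over the domain without them,
    where integrands are measurable and bounded. *)
Lemma energy_inner_product :
  inner_product (fun u v : Q1_space R d N => energy (unit_cube d) A u v).
Proof.
have [Z [mZ Z0 ZA]] := bndA; have [mF F0] := @mesh_faces_null R d N.
pose D : set 'rV[R]_d := unit_cube d `\` (@mesh_faces R d N `|` Z).
have mFZ : measurable (@mesh_faces R d N `|` Z) by exact: measurableU.
have FZ0 : lebesgue_rV d (@mesh_faces R d N `|` Z) = 0%E by rewrite measureU0.
have mD : measurable D by apply: measurableD => //; exact: measurable_unit_cube.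
have DI : D `<=` unit_cube d `\` @mesh_faces R d N.
  by move=> x [xD xFZ]; split=> // xF; apply: xFZ; left.
have DA x : D x -> alpha <= A x <= beta.
  move=> [xD xFZ]; apply: contrapT => Ax; apply: xFZ; right; apply: ZA => /=.
  by move=> /(_ xD).
have energyD u v : energy (unit_cube d) A u v = energy D A u v.
  by rewrite /energy /Rintegral (integral_setD_null _ _ mFZ FZ0).
split=> [u v|u c v w|u uN0]; first exact: energyC.
  by rewrite !energyD; exact: (energy_linear mD DI DA).
rewrite energyD lt_def (energy_ge0 DA) andbT; apply/eqP.
move=> /(energy_eq0 mD DI DA)[Y [mY Y0 uY]].
move/eqP: uN0; apply.
apply: (@Q1_eq0 _ _ _ N0 u (Ordinal d0) ((@mesh_faces R d N `|` Z) `|` Y)).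
- exact: measurableU.
- by rewrite measureU0.
- move=> x xD xZ; apply: uY => [|Yx]; last by apply: xZ; right.
  by split=> // h; apply: xZ; left.
Qed.

End Q1_energy.

(** * Measurability of the coefficient *)

Section realization.
Context {R : realType} {d : nat}.

Lemma measurable_scale_shift (c : R) (y : 'rV[R]_d) :
  measurable_fun [set: 'rV[R]_d] (fun x : 'rV[R]_d => c *: x + y).
Proof.
apply: measurable_fun_rV => i.
rewrite (_ : (fun _ => _) = (fun x : 'rV[R]_d => c * x 0 i + y 0 i)).
  apply: measurable_funD; last exact: measurable_cst.
  by apply: measurable_funM; [exact: measurable_cst|exact: measurable_rV_coord].
by apply/funext => x; rewrite !mxE.
Qed.

Lemma measurable_oscillating (eps : R) (g : 'rV[R]_d -> R) :
  measurable_fun [set: 'rV[R]_d] g ->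
  measurable_fun [set: 'rV[R]_d] (oscillating eps g).
Proof.
move=> mg; apply: measurableT_comp => //.
rewrite (_ : *:%R eps^-1 = fun x : 'rV[R]_d => eps^-1 *: x + 0).
  exact: measurable_scale_shift.
by apply/funext => x; rewrite addr0.
Qed.

Lemma measurable_defect_cell (eps : R) (Q : set 'rV[R]_d) j : eps != 0 ->
  measurable Q -> measurable (defect_cell eps Q j).
Proof.
move=> eps0 mQ.
rewrite (_ : defect_cell _ _ _ = (fun x => eps^-1 *: x + - int_vec j) @^-1` Q).
  by rewrite -[X in measurable X]setTI; exact: measurable_scale_shift.
apply/seteqP; split => [x [q Qq <-]|x Qx] /=.
  by rewrite scalerA mulVf// scale1r addrC addrA addNr add0r.
exists (eps^-1 *: x - int_vec j) => //.
by rewrite addrC subrK scalerA mulfV// scale1r.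
Qed.

(** A site [j] satisfies [0 <= eps (j + q) <= 1] in every coordinate. *)
Lemma finite_defect_sites (eps : R) (Q : set 'rV[R]_d) : 0 < eps ->
  Q !=set0 -> finite_set (defect_sites eps Q (unit_cube d)).
Proof.
move=> eps0 [q Qq].
pose b := (\max_(i < d) Num.bound (eps^-1 + `|q 0%R i|)%R)%N.
pose row (f : {ffun 'I_d -> 'I_(b + b).+1}) : 'rV[int]_d :=
  \row_i ((f i)%:Z - b%:Z).
apply: (@sub_finite_set _ _ (row @` setT)); last first.
  by apply: finite_image; exact: finite_finset.
move=> j jQ.
have jb i : (absz (j 0%R i) <= b)%N.
  apply: leq_trans (leq_bigmax i).
  have := jQ _ (ex_intro2 _ _ q Qq erefl) i; rewrite !mxE => /andP[h0 h1].
  rewrite -(ler_nat R) natr_absz intr_norm.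
  apply: le_trans (ltW (archi_boundP _)); last first.
    by rewrite addr_ge0// invr_ge0 ltW.
  have {}h0 : 0 <= (j 0 i)%:~R + q 0 i by rewrite -(pmulr_rge0 _ eps0).
  have {}h1 : (j 0 i)%:~R + q 0 i <= eps^-1.
    by rewrite -(ler_pM2l eps0) mulfV// gt_eqF.
  have : 0 <= eps^-1 by rewrite invr_ge0 ltW.
  have := ler_norm (q 0 i); have := ler_norm (- q 0 i).
  by rewrite normrN ler_norml; lra.
pose f i := inord (absz (j 0 i + b%:Z)) : 'I_(b + b).+1.
exists [ffun i => f i] => //; apply/rowP => i; rewrite mxE ffunE.
have := jb i; rewrite -lez_nat abszE ler_norml => /andP[jl ju].
have jpos : 0 <= j 0 i + b%:Z by rewrite -(lerD2r (- b%:Z)) addrK add0r.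
rewrite inordK; first by rewrite gez0_abs// addrK.
by rewrite ltnS -lez_nat gez0_abs// PoszD lerD2r.
Qed.

Lemma measurable_realization (eps : R) (Aper Bper : 'rV[R]_d -> R) Q b :
  0 < eps -> measurable Q ->
  measurable_fun [set: 'rV[R]_d] Aper -> measurable_fun [set: 'rV[R]_d] Bper ->
  measurable_fun [set: 'rV[R]_d] (realization eps Aper Bper Q b).
Proof.
move=> eps0 mQ mA mB.
apply: measurable_funD; first exact: measurable_oscillating.
(* For empty [Q] every lattice point is a site, but all cells are empty. *)
have [->|/set0P Q0] := eqVneq Q set0.
  rewrite (_ : (fun _ => _) = cst 0); first exact: measurable_cst.
  apply/funext => x; rewrite /= fsbig1// => j _.
  by rewrite /defect_cell image_set0 indic0 mulr0 mul0r.
have Sfin := finite_defect_sites eps0 Q0.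
rewrite (_ : (fun _ => _) = fun x =>
    \sum_(j <- finmap.enum_fset (fset_set (defect_sites eps Q (unit_cube d))))
     (b j)%:R * \1_(defect_cell eps Q j) x * oscillating eps Bper x);
  last by apply/funext => x; rewrite fsbig_finite.
apply: measurable_sum => j.
apply: measurable_funM; last exact: measurable_oscillating.
apply: measurable_funM; first exact: measurable_cst.
by apply: measurable_indic; apply: measurable_defect_cell => //; rewrite gt_eqF.
Qed.

End realization.

(** * Finite dimension of the finite element space *)

(** The multilinear coefficients on all cells determine the function, since
    the cells cover the cube and the function is zero outside. *)
Lemma Q1_space_finite_basis (R : realType) d N : (0 < N)%N ->
  exists m (e : 'I_m -> Q1_space R d N), finite_basis e.
Proof.
move=> N0.
pose J := ({ffun 'I_d -> 'I_N} * {set 'I_d})%type.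
pose C (u : Q1_space R d N) : 'rV[R]_#|{: J}| :=
  \row_j Q1_coef u (enum_val j).1 (enum_val j).2.
apply: (@basis_of_coordinates _ _ _ C) => m e x xC.
apply/val_inj/funext => y.
have lincombE : Q1_val (lincomb e x) y = \sum_i x 0 i * e i y.
  rewrite /lincomb; elim/big_rec2: _ => // i r u _ ur.
  by rewrite Q1_valP -ur.
rewrite [LHS]lincombE; have [yD|yD] := pselect (unit_cube d y); last first.
  rewrite big1// => i _; have [_ u_out _] := Q1_spaceP (e i).
  by rewrite u_out// mulr0.
have [k ky] := unit_cube_mesh_cell N0 yD.
under eq_bigr do rewrite (Q1_coefP _ ky) /multilinear mulr_sumr.
rewrite exchange_big big1// => S _ /=.
under eq_bigr do rewrite mulrA.
rewrite -mulr_suml (_ : \sum_i _ = 0) ?mul0r//.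
have /rowP/(_ (enum_rank (k, S))) := xC; rewrite !mxE => xC0.
rewrite -[RHS]xC0; apply: eq_bigr => i _.
by rewrite !mxE enum_rankK.
Qed.

(** * The perturbed additive preconditioner *)

Section operators.
Variables (R : realType) (V : lmodType R) (a : V -> V -> R).
Hypothesis ia : inner_product a.

Lemma selfadjointD (S T : V -> V) : selfadjoint a S -> selfadjoint a T ->
  selfadjoint a (fun v => S v + T v).
Proof. by move=> aS aT u v; rewrite !(innerE ia) aS aT. Qed.

Lemma selfadjoint_sum (I : finType) (T : I -> V -> V) :
  (forall i, selfadjoint a (T i)) -> selfadjoint a (fun v => \sum_i T i v).
Proof.
move=> aT u v; rewrite (inner_suml ia) (inner_sumr ia).
by apply: eq_bigr => i _; exact: aT.
Qed.

Lemma selfadjointZ c (T : V -> V) : selfadjoint a T ->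
  selfadjoint a (fun v => c *: T v).
Proof. by move=> aT u v; rewrite !(innerE ia) aT. Qed.

(** Testing the local problem for each of [u] and [v] against the solution for
    the other turns both sides into [a' (B (a u)) (B (a v))]. *)
Lemma solution_operator_selfadjoint (a' : V -> V -> R) W B :
  (forall u v, a' u v = a' v u) -> solution_operator a' W B ->
  selfadjoint a (fun v => B (a v)).
Proof.
move=> a'C BP u v; have [_ lin _] := ia.
have [Wu Bu] := BP _ (lin u); have [Wv Bv] := BP _ (lin v).
by rewrite (innerC ia) -Bv// -Bu// a'C.
Qed.

(** [a (T v) v] exceeds [a (S v) v - C1 |v|^2], which is nonnegative. *)
Lemma deviation_positive (S T : V -> V) C1 v :
  C1 * form_norm a v ^+ 2 <= a (S v) v ->
  (relative_deviation a T S < C1%:E)%E -> v != 0 -> 0 < a (T v) v.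
Proof.
move=> Sv TS vN0.
have : ((`|a (T v - S v) v| / form_norm a v ^+ 2)%:E < C1%:E)%E.
  by apply: le_lt_trans TS; apply: ereal_sup_ubound; exists v.
rewrite lte_fin form_norm_sqr// ltr_pdivrMr ?(inner_gt0 ia)//.
rewrite !(innerE ia) ltr_norml form_norm_sqr// in Sv *.
lra.
Qed.

End operators.

Unset Implicit Arguments.

Theorem corollary4p7 (R : realType) (d n M : nat)
    (hd : (1 <= d <= 3)%N) (hM : (0 < M)%N) (hMn : (M %| n)%N) (hHh : (M < n)%N)
    (eps : R) (heps : n%:R^-1 <= eps < M%:R^-1)
    (Aper Bper : 'rV[R]_d -> R) (alpha beta : R)
    (mAper : measurable_fun [set: 'rV[R]_d] Aper)
    (mBper : measurable_fun [set: 'rV[R]_d] Bper)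
    (pAper : unit_periodic Aper) (pBper : unit_periodic Bper)
    (halpha : 0 < alpha) (hbeta : alpha <= beta)
    (bndA : {ae lebesgue_rV d, forall y, alpha <= Aper y <= beta})
    (bndAB : {ae lebesgue_rV d, forall y, alpha <= Aper y + Bper y <= beta})
    (Q : set 'rV[R]_d) (mQ : measurable Q) (hQ : Q `<=` unit_cube d)
    (aligned : forall k k' : {ffun 'I_d -> 'I_M},
       {ae lebesgue_rV d, forall x, mesh_cell k x ->
          oscillating eps Aper
            (x + \row_i ((k' i)%:R / M%:R - (k i)%:R / M%:R)) =
          oscillating eps Aper x})
    (b : 'rV[int]_d -> bool)
    (A := realization eps Aper Bper Q b)
    (bndR : {ae lebesgue_rV d, forall x, unit_cube d x ->
               alpha <= A x <= beta})
    (phi : {ffun 'I_d -> 'I_M.-1} -> Q1_space R d n) (hphi : nodal_basis phi)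
    (omega := fun i => support_of (phi i))
    (omega_ref : set 'rV[R]_d) (t : {ffun 'I_d -> 'I_M.-1} -> 'rV[R]_d)
    (homega : forall i, omega i = [set y + t i | y in omega_ref])
    (Nref : nat) (jref : 'I_Nref -> 'rV[int]_d) (jref_inj : injective jref)
    (jref_enum : range jref = defect_sites eps Q omega_ref)
    (Aref := fun i (l : 'I_Nref.+1) x =>
       reference_coef jref eps Aper Bper Q l (x - t i))
    (mu := fun i (l : 'I_Nref.+1) => patch_weight jref eps Q b (t i) l)
    (hrepr : forall i, {ae lebesgue_rV d, forall x, omega i x ->
               A x = \sum_(l < Nref.+1) mu i l * Aref i l x})
    (a := fun u v : Q1_space R d n => energy (unit_cube d) A u v)
    (L := fun v w : Q1_space R d n => a v w)
    (B0 : (Q1_space R d n -> R) -> Q1_space R d n)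
    (hB0 : solution_operator a (coarse_space M) B0)
    (B : {ffun 'I_d -> 'I_M.-1} -> (Q1_space R d n -> R) -> Q1_space R d n)
    (hB : forall i, solution_operator a (patch_space (omega i)) (B i))
    (Bref : {ffun 'I_d -> 'I_M.-1} -> 'I_Nref.+1 ->
       (Q1_space R d n -> R) -> Q1_space R d n)
    (hBref : forall i l,
       solution_operator
         (fun u w : Q1_space R d n => energy (omega i) (Aref i l) u w)
         (patch_space (omega i)) (Bref i l))
    (Btilde := fun i g => \sum_(l < Nref.+1) mu i l *: Bref i l g)
    (P := fun v => additive_preconditioner B0 B (L v))
    (Ptilde := fun v => additive_preconditioner B0 Btilde (L v))
    (C1 C2 : R) (hC1 : 0 < C1) (hC2 : 0 < C2)
    (hP : forall v, C1 * form_norm a v ^+ 2 <= a (P v) v /\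
                    a (P v) v <= C2 * form_norm a v ^+ 2)
    (heta : (relative_deviation a Ptilde P < C1%:E)%E)
    (f : 'rV[R]_d -> R) (hf : L2 (unit_cube d) f)
    (uh : Q1_space R d n)
    (huh : forall w, L uh w = L2_pairing (unit_cube d) f w)
    (u0 : Q1_space R d n) (k : nat) (uk : Q1_space R d n)
    (huk : pcg_iterate a Ptilde uh u0 k uk) :
  form_norm a (uh - uk) <=
    2 * ((Num.sqrt (condition_number Ptilde) - 1) /
         (Num.sqrt (condition_number Ptilde) + 1)) ^+ k * form_norm a (uh - u0).
Proof.
have n0 : (0 < n)%N by exact: leq_trans hM (ltnW hHh).
have eps0 : 0 < eps.
  by have /andP[+ _] := heps; apply: lt_le_trans; rewrite invr_gt0 ltr0n.
have d0 : (0 < d)%N by have /andP[] := hd.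
have mA : measurable_fun (unit_cube d) A.
  by apply: measurable_funTS; exact: measurable_realization.
have ia : inner_product a := energy_inner_product n0 mA halpha d0 bndR.
have [m [e be]] := @Q1_space_finite_basis R d n n0.
apply: (conjugate_gradient_rate ia be _ _ huk).
  apply: (selfadjointD ia).
    exact: (solution_operator_selfadjoint ia (innerC ia) hB0).
  apply: (selfadjoint_sum ia) => i; apply: (selfadjoint_sum ia) => l.
  apply: (selfadjointZ ia).
  apply: (solution_operator_selfadjoint ia _ (hBref i l)) => u v.
  exact: energyC.
move=> v; exact: (deviation_positive ia (proj1 (hP v)) heta).
Qed.
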